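(* Assume that a saddle point exists ($\mathcal{M}^*\neq\emptyset$), that each $f_i:\mathbb{R}^n\to\mathbb{R}$ is convex and differentiable with $L_i$-Lipschitz continuous gradient, and that each $g_i:\mathbb{R}^p\to(-\infty,+\infty]$ is convex, proper and closed ($i=1,\dots,m$). Assume $0<\tau_i<2/L_i$ and $0<\tau_i\beta<1$ for $i=1,\dots,m$. Let $\{(\tilde{\mathbf{x}}^k,\mathbf{x}^k,\mathbf{y}^k)\}$ be generated by V-DISA, and put $\mathbf{w}^k=(\mathbf{x}^k,\mathbf{y}^k)$, $\mathbf{v}^k=(\tilde{\mathbf{x}}^k,\mathbf{y}^k)$. If $\sum_{k=0}^{\infty}\varepsilon^k<\infty$, then for any $\mathbf{w}^*\in\mathcal{M}^*$ the sequences $\{\|\mathbf{w}^k-\mathbf{w}^*\|\}$ and $\{\|\mathbf{v}^k-\mathbf{w}^*\|\}$ are bounded. Moreover, there exists $\mathbf{w}^{\infty}\in\mathcal{M}^*$ such that $\lim_{k\to\infty}\mathbf{w}^k=\mathbf{w}^{\infty}$; and, writing $\mathbf{x}^k=(\mathrm{x}_1^k,\mathrm{x}_2^k)$ with $\mathrm{x}_1^k\in\mathbb{R}^{mn}$, one has $\lim_{k\to\infty}\mathrm{x}_1^k=1_m\otimes\mathrm{x}^{\infty}$, where $\mathrm{x}^{\infty}\in\mathbb{R}^n$ solves $\min_{\mathrm{x}\in\mathbb{R}^n}\sum_{i=1}^m\big(f_i(\mathrm{x})+g_i(U_i\mathrm{x})\big)$.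
   Context: Network and problem. $\mathcal{G}=(\mathcal{V},\mathcal{E})$ is an undirected connected graph with $m$ nodes. $W=[W_{ij}]\in\mathbb{R}^{m\times m}$ is symmetric and doubly stochastic with $\mathrm{null}(I-W)=\mathrm{Span}(1_m)$ ($1_m$ the all-ones vector), $W_{ij}=0$ if $i\neq j$ and $(i,j)\notin\mathcal{E}$, and $W_{ij}>0$ otherwise; consequently $1$ is a simple eigenvalue of $W$ and all other eigenvalues lie in $(-1,1)$. $U_i\in\mathbb{R}^{p\times n}$ are given matrices, $L_i>0$. Lifted form. For $\mathbf{x}=(\mathrm{x}_1,\mathrm{x}_2)\in\mathbb{R}^{mn}\times\mathbb{R}^{mp}=\mathbb{R}^{m(n+p)}$ with blocks $\mathrm{x}_{1,i}\in\mathbb{R}^n$, $\mathrm{x}_{2,i}\in\mathbb{R}^p$, let $F(\mathbf{x})=\sum_{i=1}^m f_i(\mathrm{x}_{1,i})$, $G(\mathbf{x})=\sum_{i=1}^m g_i(\mathrm{x}_{2,i})$, $\mathbf{V}=\frac12(I-W)\otimes I_n$, $\mathbf{U}=\mathrm{diag}\{U_1,\dots,U_m\}$ and $$\mathbf{B}=\begin{pmatrix}\sqrt{\mathbf{V}}&0\\ \mathbf{U}&-I\end{pmatrix},$$ where $\sqrt{\mathbf V}$ is the positive semidefinite square root. The Lagrangian is $\mathcal{L}(\mathbf{x},\mathbf{y})=F(\mathbf{x})+G(\mathbf{x})+\langle\mathbf{y},\mathbf{B}\mathbf{x}\rangle$, $\mathbf{y}\in\mathbb{R}^{m(n+p)}$.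 $\mathcal{M}^*$ is the set of saddle points $(\mathbf{x}^*,\mathbf{y}^* )$ of $\mathcal{L}$, i.e. $\mathcal{L}(\mathbf{x}^*,\mathbf{y})\le\mathcal{L}(\mathbf{x}^*,\mathbf{y}^* )\le\mathcal{L}(\mathbf{x},\mathbf{y}^* )$ for all $\mathbf{x},\mathbf{y}$. V-DISA (DISA with approximate proximal mapping). Given $\tau_i>0$, $\beta>0$, put $\tau=\max_i\tau_i$, $\Gamma_1=\mathrm{diag}\{\tau_1I_n,\dots,\tau_mI_n\}$, $\Gamma_2=\mathrm{diag}\{\tau_1I_p,\dots,\tau_mI_p\}$, $\Gamma=\mathrm{diag}\{\Gamma_1,\Gamma_2\}$, and $$\mathbf{Q}=\begin{pmatrix}\frac1\beta I&0\\0&\mathbf{S}\end{pmatrix},\qquad \mathbf{S}=2\Gamma_2+\mathbf{U}\Gamma_1\mathbf{U}^{\top}+\frac{\beta}{1-\tau\beta}\mathbf{U}\Gamma_1^2\mathbf{U}^{\top}.$$ For symmetric positive (semi)definite $H$, $\|z\|_H^2=\langle z,Hz\rangle$, and $\mathrm{prox}^{\Gamma^{-1}}_{G}(\mathbf{v})=\arg\min_{\mathbf{x}}\{G(\mathbf{x})+\frac12\|\mathbf{x}-\mathbf{v}\|^2_{\Gamma^{-1}}\}$. Let $\{\varepsilon^k\}$ be a sequence of nonnegative numbers. Starting from arbitrary $\mathbf{x}^0$ and $\mathbf{y}^0=0$, V-DISA iterates for $k\ge0$: $$\tilde{\mathbf{x}}^{k+1}=\mathrm{prox}^{\Gamma^{-1}}_{G}\big(\mathbf{x}^k-\Gamma\nabla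 F(\mathbf{x}^k)-\Gamma\mathbf{B}^{\top}\mathbf{y}^k+\Gamma\mathbf{d}^k\big),$$ $$\mathbf{y}^{k+1}=\arg\min_{\mathbf{y}}\Big\{\tfrac12\|\mathbf{y}-\mathbf{y}^k\|^2_{\mathbf{Q}}-\langle\mathbf{B}^{\top}\mathbf{y},\tilde{\mathbf{x}}^{k+1}\rangle\Big\},$$ $$\mathbf{x}^{k+1}=\tilde{\mathbf{x}}^{k+1}+\Gamma\mathbf{B}^{\top}(\mathbf{y}^k-\mathbf{y}^{k+1}),$$ where $\mathbf{d}^k=(0,\mathrm{d}^k)\in\mathbb{R}^{mn}\times\mathbb{R}^{mp}$ is an error vector whose blocks $\mathrm{d}^k_i\in\mathbb{R}^p$ satisfy $\|\mathrm{d}_i^k\|\le\varepsilon^k$ for $i=1,\dots,m$ (equivalently, $\mathrm{d}_i^k\in\partial g_i(\tilde{\mathrm{x}}_{2,i}^{k+1})-\mathrm{y}_{2,i}^k+\frac1{\tau_i}(\tilde{\mathrm{x}}_{2,i}^{k+1}-\mathrm{x}_{2,i}^k)$). *)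

(* Defs.v *)
(* MathComp / MathComp-Analysis, over an arbitrary R : realType. *)
From HB Require Import structures.
From mathcomp Require Import all_boot all_order all_algebra.
From mathcomp Require Import all_classical all_reals all_analysis.
From mathcomp Require Import mxtens.

Set Implicit Arguments.
Unset Strict Implicit.
Unset Printing Implicit Defensive.

Import Order.TTheory GRing.Theory Num.Theory.
Import numFieldNormedType.Exports.

Local Open Scope classical_set_scope.
Local Open Scope ring_scope.

Section Euclidean.
Context {R : realType}.

Definition dot {N : nat} (u v : 'cV[R]_N) : R := \sum_(i < N) u i 0 * v i 0.

(* The norm `|u| that the library puts on matrices is the sup norm. *)
Definition enorm {N : nat} (u : 'cV[R]_N) : R := Num.sqrt (dot u u).

Definition sqnorm_wrt {N : nat} (H : 'M[R]_N) (z : 'cV[R]_N) : R :=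
  dot z (H *m z).

Definition grad {N : nat} (f : 'cV[R]_N -> R) (x : 'cV[R]_N) : 'cV[R]_N :=
  \col_(j < N) 'D_(delta_mx j 0 : 'cV[R]_N) f x.

Definition bounded_seq (u : nat -> R) : Prop :=
  exists C : R, forall k, `|u k| <= C.

End Euclidean.

Section ConvexAnalysis.
Context {R : realType}.

(* A minimizer must have a value < +oo: argmin is empty if h is +oo
   everywhere. *)
Definition argmin {T : Type} (h : T -> \bar R) : set T :=
  [set x | (h x < +oo)%E /\ forall z, (h x <= h z)%E].

Context {N : nat}.
Implicit Type g : 'cV[R]_N -> \bar R.

(* The values 0 and 1 of t are left out, so that no product 0 * +oo occurs. *)
Definition econvex g : Prop :=
  forall (x y : 'cV[R]_N) (t : R), 0 < t < 1 ->
    (g (t *: x + (1 - t) *: y)%R <= t%:E * g x + (1 - t)%:E * g y)%E.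

Definition eproper g : Prop :=
  (forall x, g x != -oo%E) /\ (exists x, (g x < +oo)%E).

(* closedness of the epigraph *)
Definition closed_fun g : Prop :=
  closed [set z : 'cV[R]_N * R | (g z.1 <= z.2%:E)%E].

End ConvexAnalysis.

Section SquareRoot.
Context {R : realType} {N : nat}.

Definition psd (A : 'M[R]_N) : Prop :=
  A^T = A /\ forall z : 'cV[R]_N, 0 <= dot z (A *m z).

(* A positive semidefinite matrix has exactly one such square root. *)
Definition psd_sqrt (A : 'M[R]_N) : 'M[R]_N :=
  xget 0 [set S : 'M[R]_N | psd S /\ S *m S = A].

End SquareRoot.

Section Network.
Context {R : realType} {m : nat}.

Definition undirected_connected (E : rel 'I_m) : Prop :=
  symmetric E /\ forall i j, connect E i j.

Definition doubly_stochastic (W : 'M[R]_m) : Prop :=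
  [/\ forall i j, 0 <= W i j,
      forall i, \sum_(j < m) W i j = 1 &
      forall j, \sum_(i < m) W i j = 1].

Definition mixing_matrix (E : rel 'I_m) (W : 'M[R]_m) : Prop :=
  [/\ W^T = W,
      doubly_stochastic W,
      [set v : 'cV[R]_m | (1%:M - W) *m v = 0] =
        [set c *: (const_mx 1 : 'cV[R]_m) | c in [set: R]],
      forall i j, i != j -> ~~ E i j -> W i j = 0 &
      forall i j, (i == j) || E i j -> 0 < W i j].

End Network.

Section Lifted.
Context {R : realType} {m : nat}.

(* A vector of R^(m q) is a stack of m blocks of R^q, indexed as in the
   Kronecker product tensmx: entry a of block i is at mxtens_index (i, a). *)
Definition blk {q : nat} (i : 'I_m) (x : 'cV[R]_(m * q)) : 'cV[R]_q :=
  \col_(a < q) x (mxtens_index (i, a)) 0.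

Definition bdiag {r q : nat} (A : 'I_m -> 'M[R]_(r, q)) :
    'M[R]_(m * r, m * q) :=
  \sum_(i < m) tensmx (delta_mx i i : 'M[R]_m) (A i).

Context {n p : nat}.

Definition Fsum (f : 'I_m -> 'cV[R]_n -> R) (x : 'cV[R]_(m * n + m * p)) : R :=
  \sum_(i < m) f i (blk i (usubmx x)).

Definition Gsum (g : 'I_m -> 'cV[R]_p -> \bar R)
    (x : 'cV[R]_(m * n + m * p)) : \bar R :=
  (\sum_(i < m) g i (blk i (dsubmx x)))%E.

Definition Vmat (W : 'M[R]_m) : 'M[R]_(m * n) :=
  tensmx (2^-1 *: (1%:M - W)) (1%:M : 'M[R]_n).

Definition Bmat (W : 'M[R]_m) (U : 'I_m -> 'M[R]_(p, n)) :
    'M[R]_(m * n + m * p) :=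
  block_mx (psd_sqrt (Vmat W)) 0 (bdiag U) (- 1%:M).

Definition lagrangian (W : 'M[R]_m) (U : 'I_m -> 'M[R]_(p, n))
    (f : 'I_m -> 'cV[R]_n -> R) (g : 'I_m -> 'cV[R]_p -> \bar R)
    (x y : 'cV[R]_(m * n + m * p)) : \bar R :=
  ((Fsum f x)%:E + Gsum g x + (dot y (Bmat W U *m x))%:E)%E.

(* A primal-dual pair (x, y) is encoded as the stacked vector col_mx x y. *)
Definition saddle_points (W : 'M[R]_m) (U : 'I_m -> 'M[R]_(p, n))
    (f : 'I_m -> 'cV[R]_n -> R) (g : 'I_m -> 'cV[R]_p -> \bar R) :
    set 'cV[R]_((m * n + m * p) + (m * n + m * p)) :=
  [set w | forall x y : 'cV[R]_(m * n + m * p),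
    (lagrangian W U f g (usubmx w) y
       <= lagrangian W U f g (usubmx w) (dsubmx w))%E /\
    (lagrangian W U f g (usubmx w) (dsubmx w)
       <= lagrangian W U f g x (dsubmx w))%E].

Definition Gamma_blk (q : nat) (tau : 'I_m -> R) : 'M[R]_(m * q) :=
  bdiag (fun i => (tau i)%:M : 'M[R]_q).

Definition Gamma (tau : 'I_m -> R) : 'M[R]_(m * n + m * p) :=
  block_mx (Gamma_blk n tau) 0 0 (Gamma_blk p tau).

(* The maximum of the tau i, which are positive. *)
Definition tau_max (tau : 'I_m -> R) : R := \big[Num.max/0]_(i < m) tau i.

Definition Smat (U : 'I_m -> 'M[R]_(p, n)) (tau : 'I_m -> R) (beta : R) :
    'M[R]_(m * p) :=
  let G1 := Gamma_blk n tau in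
  2 *: Gamma_blk p tau + bdiag U *m G1 *m (bdiag U)^T
  + (beta / (1 - tau_max tau * beta)) *: (bdiag U *m (G1 *m G1) *m (bdiag U)^T).

Definition Qmat (U : 'I_m -> 'M[R]_(p, n)) (tau : 'I_m -> R) (beta : R) :
    'M[R]_(m * n + m * p) :=
  block_mx (beta^-1)%:M 0 0 (Smat U tau beta).

Definition prox (H : 'M[R]_(m * n + m * p))
    (G : 'cV[R]_(m * n + m * p) -> \bar R) (v : 'cV[R]_(m * n + m * p)) :
    set 'cV[R]_(m * n + m * p) :=
  argmin (fun x => (G x + (2^-1 * sqnorm_wrt H (x - v))%:E)%E).

(* The sequences xt, x, y are generated by the iteration with errors d bounded
   by eps. The iterates xt are indexed from 1: the value xt 0 is arbitrary. *)
Definition VDISA (W : 'M[R]_m) (U : 'I_m -> 'M[R]_(p, n))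
    (f : 'I_m -> 'cV[R]_n -> R) (g : 'I_m -> 'cV[R]_p -> \bar R)
    (tau : 'I_m -> R) (beta : R) (eps : nat -> R) (d : nat -> 'cV[R]_(m * p))
    (xt x y : nat -> 'cV[R]_(m * n + m * p)) : Prop :=
  let B := Bmat W U in
  let Gam := Gamma tau in
  y 0%N = 0 /\
  forall k : nat,
    [/\ forall i : 'I_m, enorm (blk i (d k)) <= eps k,
        prox (invmx Gam) (Gsum g)
          (x k - Gam *m grad (Fsum f) (x k) - Gam *m (B^T *m y k)
             + Gam *m col_mx 0 (d k))
          (xt k.+1),
        argmin (fun z =>
            (2^-1 * sqnorm_wrt (Qmat U tau beta) (z - y k)
               - dot (B^T *m z) (xt k.+1))%:E)
          (y k.+1) &
        x k.+1 = xt k.+1 + Gam *m (B^T *m (y k - y k.+1))].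

End Lifted.

(* Main.v *)
Require Import Defs.
From HB Require Import structures.
From mathcomp Require Import all_boot all_order all_algebra.
From mathcomp Require Import all_classical all_reals all_analysis.
From mathcomp Require Import mxtens.
From mathcomp Require Import ring lra.

Set Implicit Arguments.
Unset Strict Implicit.
Unset Printing Implicit Defensive.

Import Order.TTheory GRing.Theory Num.Theory.
Import numFieldNormedType.Exports.

Local Open Scope classical_set_scope.
Local Open Scope ring_scope.

(** Each step of the method is a first-order optimality condition. The
    subgradient inclusion for [xt k.+1] and the one for a saddle point
    [(xs, ys)] combine, by monotonicity of the subdifferential of the
    nonsmooth part, into a Fejer-type inequality for the squared distance of
    [(x k, y k)] to [(xs, ys)], measured by [invmx (Gamma tau)] on the primal
    side and by [Qmat] on the dual side ([fejer_step]). The distance decreases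
    by a multiple of [|x k - xt k.+1|^2 + |y k - y k.+1|^2], up to a term that
    is linear in the error [d k].

    Two facts make the decrease genuine. On the primal side, cocoercivity of
    the gradients (Baillon--Haddad, [convex_ge_tangent_grad]) lets
    [|x k - xt k.+1|^2] absorb the evaluation of the gradient at [x k] instead
    of [xt k.+1], as soon as [tau i < 2 / L i] ([grad_Fsum_absorbed]). On the
    dual side, [Qmat] exceeds [B Gamma B^T] by a positive definite matrix
    ([Qmat_dominates]): [1 - Vmat W] is symmetric and entrywise nonnegative,
    with unit row sums and diagonal entries above [1 / 2], so the eigenvalues
    of [Vmat W] stay away from 1, and the last summand of [Smat] completes a
    square.

    Summability of the errors then gives, by a deterministic Robbins--Siegmund
    argument ([quasi_fejer_cvg]), that the distance to every saddle point
    converges and that the successive differences tend to 0. The iterates are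
    bounded, so they converge along an ultrafilter finer than [\oo]; lower
    semicontinuity lets the optimality conditions pass to the limit
    ([subdiff_closed]), which is therefore a saddle point. The distance to this
    particular saddle point converges along [\oo] and tends to 0 along the
    ultrafilter, hence tends to 0 ([primal_dual_cvg]).

    Finally, saddle points are the solutions of the optimality system [kkt]
    ([saddle_kktP]), and the kernel of [B] consists of the vectors
    [lift_consensus U z] ([Bmat_ker]), on which the Lagrangian is the objective
    of the consensus problem. *)

(** * Euclidean inner product and norm *)

Section EuclideanSpace.
Context {R : realType}.

Section InnerProduct.
Context {N : nat}.
Implicit Types u v z : 'cV[R]_N.

Lemma dotC u v : dot u v = dot v u.
Proof. by apply: eq_bigr => i _; rewrite mulrC. Qed.

Lemma dotDl u v z : dot (u + v) z = dot u z + dot v z.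
Proof. by rewrite -big_split; apply: eq_bigr => i _; rewrite mxE mulrDl. Qed.

Lemma dotZl a u z : dot (a *: u) z = a * dot u z.
Proof. by rewrite /dot mulr_sumr; apply: eq_bigr => i _; rewrite mxE mulrA. Qed.

Lemma dotNl u z : dot (- u) z = - dot u z.
Proof. by rewrite -scaleN1r dotZl mulN1r. Qed.

Lemma dotBl u v z : dot (u - v) z = dot u z - dot v z.
Proof. by rewrite dotDl dotNl. Qed.

Lemma dotDr z u v : dot z (u + v) = dot z u + dot z v.
Proof. by rewrite dotC dotDl !(dotC z). Qed.

Lemma dotZr a z u : dot z (a *: u) = a * dot z u.
Proof. by rewrite dotC dotZl (dotC z). Qed.

Lemma dotNr z u : dot z (- u) = - dot z u.
Proof. by rewrite dotC dotNl (dotC z). Qed.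

Lemma dotBr z u v : dot z (u - v) = dot z u - dot z v.
Proof. by rewrite dotDr dotNr. Qed.

Lemma dot0l z : dot 0 z = 0.
Proof. by rewrite -(scale0r 0) dotZl mul0r. Qed.

Lemma dot0r z : dot z 0 = 0.
Proof. by rewrite dotC dot0l. Qed.

Lemma dot_sumr (I : Type) (r : seq I) (P : pred I) (w : I -> 'cV[R]_N) z :
  dot z (\sum_(i <- r | P i) w i) = \sum_(i <- r | P i) dot z (w i).
Proof.
by elim/big_rec2: _ => [|i a b _ <-]; rewrite ?dot0r // dotDr.
Qed.

Lemma dot_delta z j : dot z (delta_mx j 0) = z j 0.
Proof.
rewrite /dot (bigD1 j) //= big1 ?addr0 => [|i ij].
  by rewrite !mxE !eqxx mulr1.
by rewrite mxE (negbTE ij) mulr0.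
Qed.

Lemma dot_ge0 u : 0 <= dot u u.
Proof. by apply: sumr_ge0 => i _; rewrite -expr2 sqr_ge0. Qed.

Lemma dot_eq0 u : dot u u = 0 -> u = 0.
Proof.
move=> u0; apply/matrixP => i j; rewrite ord1 mxE.
have := u0; move/eqP; rewrite psumr_eq0 => [/allP/(_ i)|k _]; last first.
  by rewrite -expr2 sqr_ge0.
by rewrite mem_index_enum -expr2 sqrf_eq0 => /(_ isT)/eqP.
Qed.

(** [0 <= |a u - v|^2 / a]; the weight [a] is left free because cross terms are
    absorbed by squares with prescribed coefficients. *)
Lemma young a u v : 0 < a -> 2 * dot u v <= a * dot u u + a^-1 * dot v v.
Proof.
move=> a0; have /= := dot_ge0 (a *: u - v).
rewrite !(dotBl, dotBr, dotZl, dotZr) (dotC v u) => h.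
rewrite -(ler_pM2l a0) mulrDr [a * (a^-1 * _)]mulrA divff ?gt_eqF // mul1r.
by move: h; lra.
Qed.

Lemma sqr_enorm u : enorm u ^+ 2 = dot u u.
Proof. by rewrite sqr_sqrtr // dot_ge0. Qed.

Lemma enorm_ge0 u : 0 <= enorm u.
Proof. exact: sqrtr_ge0. Qed.

Lemma enormN u : enorm (- u) = enorm u.
Proof. by rewrite /enorm dotNl dotNr opprK. Qed.

Lemma enorm_le u (b : R) : 0 <= b -> (enorm u <= b) = (dot u u <= b ^+ 2).
Proof.
by move=> b0; rewrite -sqr_enorm ler_sqr ?nnegrE ?enorm_ge0.
Qed.

Lemma cauchy_schwarz u v : dot u v <= enorm u * enorm v.
Proof.
have [u0|u0] := eqVneq (enorm u) 0.
  have -> : u = 0 by apply: dot_eq0; rewrite -sqr_enorm u0 expr0n.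
  by rewrite dot0l mulr_ge0 ?enorm_ge0.
have [v0|v0] := eqVneq (enorm v) 0.
  have -> : v = 0 by apply: dot_eq0; rewrite -sqr_enorm v0 expr0n.
  by rewrite dot0r mulr_ge0 ?enorm_ge0.
have up : 0 < enorm u by rewrite lt_neqAle eq_sym u0 enorm_ge0.
have vp : 0 < enorm v by rewrite lt_neqAle eq_sym v0 enorm_ge0.
have := @young (enorm v / enorm u) u v (divr_gt0 vp up).
rewrite -!sqr_enorm invf_div.
have -> : enorm v / enorm u * enorm u ^+ 2 + enorm u / enorm v * enorm v ^+ 2 =
  2 * (enorm u * enorm v) by field; rewrite u0 v0.
by rewrite ler_pM2l.
Qed.

Lemma enormD u v : enorm (u + v) <= enorm u + enorm v.
Proof.
rewrite enorm_le ?addr_ge0 ?enorm_ge0 // dotDl !dotDr (dotC v u).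
have := cauchy_schwarz u v; rewrite -!sqr_enorm; lra.
Qed.

Lemma abs_entry_le_enorm u i : `|u i 0| <= enorm u.
Proof.
rewrite -ler_sqr ?nnegrE ?normr_ge0 ?enorm_ge0 // sqr_enorm real_normK ?num_real //.
rewrite /dot (bigD1 i) //= -expr2 lerDl; apply: sumr_ge0 => j _.
by rewrite -expr2 sqr_ge0.
Qed.

End InnerProduct.

Lemma dot_mulmx {N M : nat} (A : 'M[R]_(M, N)) (z : 'cV[R]_M) (u : 'cV[R]_N) :
  dot z (A *m u) = dot (A^T *m z) u.
Proof.
have dotE K (a b : 'cV[R]_K) : dot a b = (a^T *m b) 0 0.
  by rewrite mxE; apply: eq_bigr => i _; rewrite mxE.
by rewrite !dotE trmx_mul trmxK mulmxA.
Qed.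

Lemma dot_col_mx {N M : nat} (a c : 'cV[R]_N) (b e : 'cV[R]_M) :
  dot (col_mx a b) (col_mx c e) = dot a c + dot b e.
Proof.
rewrite /dot big_split_ord /=; congr (_ + _); apply: eq_bigr => i _.
  by rewrite !col_mxEu.
by rewrite !col_mxEd.
Qed.

Lemma mulmx_dot_bounded {N M : nat} (A : 'M[R]_(M, N)) :
  exists2 C : R, 0 < C & forall u, dot (A *m u) (A *m u) <= C * dot u u.
Proof.
pose r i : 'cV[R]_N := \col_j A i j.
have rE u i : (A *m u) i 0 = dot (r i) u.
  by rewrite mxE; apply: eq_bigr => j _; rewrite mxE.
exists (1 + \sum_i dot (r i) (r i)).
  by rewrite ltr_wpDr // sumr_ge0 // => i _; exact: dot_ge0.
move=> u; rewrite mulrDl mul1r mulr_suml ler_wpDl ?dot_ge0 //.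
apply: ler_sum => i _; rewrite rE -expr2 -!sqr_enorm -exprMn.
rewrite -[leLHS]real_normK ?num_real // ler_sqr ?nnegrE ?mulr_ge0 ?enorm_ge0 //.
rewrite ler_norml cauchy_schwarz andbT lerNl -dotNl.
by rewrite (le_trans (cauchy_schwarz _ _)) // enormN.
Qed.

End EuclideanSpace.

(** * Convex functions with Lipschitz gradient *)

Section SmoothConvex.
Local Open Scope convex_scope.
Context {R : realType}.

(** The passage from a comparison of values along a segment to a first-order
    inequality at its endpoint: divide by [t] and let [t] tend to 0. *)
Lemma ge0_of_small_quadratic (a b : R) :
  (forall t, 0 < t < 1 -> 0 <= t * a + t ^+ 2 * b) -> 0 <= a.
Proof.
move=> h; rewrite leNgt; apply/negP => a0.
have b1 : 0 < `|b| + 1 by rewrite ltr_wpDl.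
pose t := Num.min (2^-1) (- a / (2 * (`|b| + 1))).
have t0 : 0 < t by rewrite lt_min invr_gt0 ltr0n divr_gt0 ?mulr_gt0 ?oppr_gt0.
have t1 : t <= 2^-1 by rewrite ge_min lexx.
have t2 : t * (`|b| + 1) <= - a / 2.
  rewrite -ler_pdivlMr // ge_min; apply/orP; right.
  by rewrite invfM mulrA lexx.
have /h : 0 < t < 1 by rewrite t0 /=; lra.
rewrite expr2 -mulrA -mulrDr pmulr_rge0 //.
have := ler_norm b; nra.
Qed.

(** For both signs [s], the derivative of [s (phi t - dphi 0 t) - K t^2 / 2] is
    nonpositive between 0 and 1; the mean value theorem concludes. *)
Lemma first_order_remainder (phi dphi : R -> R) (K : R) :
  (forall t : R, is_derive t (1 : R) phi (dphi t)) ->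
  (forall t, 0 < t < 1 -> `|dphi t - dphi 0| <= K * t) ->
  `|phi 1 - phi 0 - dphi 0| <= K / 2.
Proof.
move=> hd hK.
suff main (s : R) : `|s| = 1 -> s * (phi 1 - phi 0 - dphi 0) <= K / 2.
  rewrite ler_norml; have := main 1 (normr1 _); have := main (-1).
  by rewrite normrN1 => /(_ erefl); lra.
move=> s1.
pose psi := fun t : R => s * (phi t - dphi 0 * t) - K / 2 * t ^+ 2.
pose dpsi := fun t : R => s * (dphi t - dphi 0) - K * t.
have dpsiE t : is_derive t (1 : R) psi (dpsi t).
  rewrite /psi; apply: is_derive_eq.
  by rewrite /dpsi /GRing.scale /=; field.
have cpsi : {within `[0, 1], continuous psi}.
  by apply: derivable_within_continuous => t _; exact: ex_derive.
have [c] := @MVT _ psi dpsi 0 1 ltr01 (fun t _ => dpsiE t) cpsi.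
rewrite in_itv /= => c01; rewrite subr0 mulr1 => e.
have : dpsi c <= 0.
  rewrite /dpsi subr_le0 (le_trans (ler_norm _)) // normrM s1 mul1r.
  exact: hK.
by rewrite -e /psi; lra.
Qed.

Context {N : nat}.
Implicit Types (f : 'cV[R]_N -> R) (x z v : 'cV[R]_N).

Lemma derive_dot_grad f x v :
  differentiable f x -> 'D_v f x = dot (grad f x) v.
Proof.
move=> df; rewrite deriveE //.
have -> : v = \sum_j v j 0 *: (delta_mx j 0 : 'cV[R]_N).
  by rewrite {1}(matrix_sum_delta v); apply: eq_bigr => j _; rewrite big_ord1.
rewrite linear_sum /= dot_sumr; apply: eq_bigr => j _.
by rewrite linearZ /= dotZr dot_delta mxE deriveE.
Qed.

Lemma is_derive_line f x v (t : R) : differentiable f (x + t *: v) ->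
  is_derive t (1 : R) (fun s => f (x + s *: v)) (dot (grad f (x + t *: v)) v).
Proof.
move=> df; rewrite -derive_dot_grad //.
have e : (fun h : R => h^-1 *:
      (((fun s : R => f (x + s *: v)) \o shift t) (h *: (1 : R)) - f (x + t *: v))) =
   (fun h : R => h^-1 *: ((f \o shift (x + t *: v)) (h *: v) - f (x + t *: v))).
  apply/funext => h /=; congr (_ *: (f _ - _)).
  by rewrite [h *: (1 : R)]mulr1 scalerDl addrCA.
split; rewrite /derivable /derive /= e //.
exact: (diff_derivable df).
Qed.

Section LipschitzGradient.
Variables (f : 'cV[R]_N -> R) (L : R).
Hypothesis df : forall x, differentiable f x.
Hypothesis lipf : forall x z,
  enorm (grad f x - grad f z) <= L * enorm (x - z).

(** Two-sided: the upper bound is the usual descent lemma, while the lower one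
    replaces limits of difference quotients in the tangent inequality for
    convex functions. *)
Lemma descent x z :
  `|f z - f x - dot (grad f x) (z - x)| <= L * dot (z - x) (z - x) / 2.
Proof.
set v := z - x.
have := @first_order_remainder (fun s => f (x + s *: v))
  (fun s => dot (grad f (x + s *: v)) v) (L * dot v v).
rewrite scale1r scale0r addr0 addrCA subrr addr0; apply.
  by move=> t; exact: is_derive_line.
move=> t /andP[t0 t1]; rewrite -dotBl.
have lip : enorm (grad f (x + t *: v) - grad f x) <= L * (t * enorm v).
  rewrite (le_trans (lipf _ _)) // addrC addKr.
  suff -> : enorm (t *: v) = t * enorm v by [].
  rewrite /enorm dotZl dotZr mulrA -expr2 sqrtrM ?sqr_ge0 // sqrtr_sqr.
  by rewrite gtr0_norm.
rewrite -sqr_enorm ler_norml.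
have := cauchy_schwarz (- (grad f (x + t *: v) - grad f x)) v.
have := cauchy_schwarz (grad f (x + t *: v) - grad f x) v.
rewrite dotNl enormN; have := enorm_ge0 v; nra.
Qed.

Hypothesis cvxf : convex_function [set: 'cV[R]_N] f.

Lemma convex_ge_tangent x z : f x + dot (grad f x) (z - x) <= f z.
Proof.
rewrite -subr_ge0; apply: (@ge0_of_small_quadratic _ (L * dot (z - x) (z - x) / 2)).
move=> t /andP[t0 t1].
have /= := @cvxf (Itv01 (ltW t0) (ltW t1)) z x (in_setT _) (in_setT _).
have -> : ((z : convex_lmodType 'cV[R]_N) <| Itv01 (ltW t0) (ltW t1) |>
    (x : convex_lmodType 'cV[R]_N)) = x + t *: (z - x).
  by rewrite /conv /= scalerBl scale1r scalerBr addrCA.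
rewrite (addrC x (t *: _)).
have := descent x (x + t *: (z - x)).
rewrite (addrC x (t *: _)) addrK dotZr dotZl dotZr ler_norml convRE => /andP[h _].
rewrite /= /unstable.onem => h2.
nra.
Qed.

(** Baillon--Haddad: a descent step of length [1/L] from [z] for
    [f - dot (grad f x)], whose minimum is at [x], already gains
    [|grad f z - grad f x|^2 / (2 L)]. *)
Lemma convex_ge_tangent_grad x z : 0 < L ->
  f x + dot (grad f x) (z - x)
    + (2 * L)^-1 * dot (grad f z - grad f x) (grad f z - grad f x) <= f z.
Proof.
move=> L0; set r := grad f z - grad f x.
have := descent z (z - L^-1 *: r); have := convex_ge_tangent x (z - L^-1 *: r).
have -> : z - L^-1 *: r - z = - (L^-1 *: r) by rewrite addrC addKr.
have rr : dot (grad f z) r - dot (grad f x) r = dot r r by rewrite -dotBl.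
clearbody r.
have e1 : L * dot (- (L^-1 *: r)) (- (L^-1 *: r)) / 2 = (2 * L)^-1 * dot r r.
  by rewrite dotNl dotNr dotZl dotZr; field; rewrite gt_eqF.
have e2 : L^-1 * dot r r = 2 * ((2 * L)^-1 * dot r r).
  by field; rewrite gt_eqF.
rewrite e1 !(dotBr, dotNr, dotZr) ler_norml => h1 /andP[_ h2].
have := congr1 (fun c => L^-1 * c) rr; rewrite /= e2 mulrBr; lra.
Qed.

(** Cocoercivity of the gradient absorbs the mismatch between the point [x]
    where it is evaluated and the point [u] where it is tested; this is what
    permits step sizes up to [2 / L]. *)
Lemma grad_monotone_shifted x u s : 0 < L ->
  - (L / 2) * dot (x - u) (x - u)
    <= 2 * dot (u - s) (grad f x - grad f s).
Proof.
move=> L0; set r := grad f x - grad f s.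
have h1 := convex_ge_tangent_grad x s L0.
have h2 := convex_ge_tangent_grad s x L0.
have e : u - s = - (x - u) + (x - s) by rewrite opprB addrA subrK.
have rE : dot (x - s) r = dot (grad f x) (x - s) - dot (grad f s) (x - s).
  by rewrite dotC dotBl.
have r2 : (2 * L)^-1 * dot r r + (2 * L)^-1 * dot r r = L^-1 * dot r r.
  by field; rewrite gt_eqF.
move: h1 h2; rewrite -(opprB (grad f x) (grad f s)) -(opprB x s) -/r.
rewrite (dotNr (grad f x)) (dotNl r) (dotNr r) opprK => h1 h2.
have := young (x - u) r (divr_gt0 L0 (ltr0Sn _ 1)).
rewrite e (dotDl (- (x - u))) (dotNl (x - u)) invf_div.
have : 2 / L * dot r r = 2 * (L^-1 * dot r r) by rewrite mulrA.
clearbody r; lra.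
Qed.

End LipschitzGradient.
End SmoothConvex.

(** * Limits along filters and quasi-Fejer sequences *)

Section Limits.
Context {R : realType}.

Section Filters.
Context {T : Type} {F : set_system T} {FF : Filter F}.

Lemma cvg_sumr {I : Type} (r : seq I) (u : I -> T -> R) (l : I -> R) :
  (forall i, u i k @[k --> F] --> l i) ->
  \sum_(i <- r) u i k @[k --> F] --> \sum_(i <- r) l i.
Proof.
move=> ul; elim: r => [|i r IH].
  by rewrite big_nil; under eq_cvg do rewrite big_nil; exact: cvg_cst.
rewrite big_cons; under eq_cvg do rewrite big_cons.
exact: cvgD.
Qed.

Lemma cvg_colP {N : nat} (u : T -> 'cV[R]_N) (l : 'cV[R]_N) :
  u k @[k --> F] --> l <-> forall i, u k i 0 @[k --> F] --> l i 0.
Proof.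
split=> [ul i|ul].
  exact: (@cvg_comp _ _ _ u (fun z : 'cV[R]_N => z i 0) _ _ _ ul
    (@coord_continuous _ _ _ i 0 l)).
apply/cvg_ballP => e e0.
have : \forall k \near F, forall i, ball (l i 0) e (u k i 0).
  by apply: filter_forall => i; move/cvg_ballP : (ul i); exact.
by apply: filterS => k h; split=> // i j; rewrite !ord1.
Qed.

Lemma cvg_dot {N : nat} (u v : T -> 'cV[R]_N) (a b : 'cV[R]_N) :
  u k @[k --> F] --> a -> v k @[k --> F] --> b ->
  dot (u k) (v k) @[k --> F] --> dot a b.
Proof.
move=> /cvg_colP ua /cvg_colP vb; apply: cvg_sumr => i.
exact: cvgM.
Qed.

Lemma cvg_mulmx {N M : nat} (A : 'M[R]_(M, N)) (u : T -> 'cV[R]_N) (a : 'cV[R]_N) :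
  u k @[k --> F] --> a -> A *m u k @[k --> F] --> A *m a.
Proof.
move=> /cvg_colP ua; apply/cvg_colP => i; rewrite mxE.
under eq_cvg do rewrite mxE.
by apply: cvg_sumr => j; apply: cvgM => //; exact: cvg_cst.
Qed.

(** The topology of column vectors comes from the sup norm; this translates
    it into the Euclidean distances that the estimates control. *)
Lemma cvg_sqdistP {N : nat} (u : T -> 'cV[R]_N) (l : 'cV[R]_N) :
  u k @[k --> F] --> l <-> dot (u k - l) (u k - l) @[k --> F] --> 0.
Proof.
split=> [ul|ul].
  have ul0 : u k - l @[k --> F] --> (0 : 'cV[R]_N).
    by rewrite -(subrr l); apply: cvgB => //; exact: cvg_cst.
  by have := cvg_dot ul0 ul0; rewrite dot0l.
apply/cvg_colP => i; apply/cvgrPdist_lt => e e0.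
have e2 : 0 < e ^+ 2 by rewrite exprn_gt0.
move/cvgrPdist_lt/(_ _ e2) : ul; apply: filterS => k.
rewrite sub0r normrN ger0_norm ?dot_ge0 // -sqr_enorm ltr_sqr ?nnegrE ?enorm_ge0 ?ltW //.
apply: le_lt_trans; rewrite distrC.
by have := abs_entry_le_enorm (u k - l) i; rewrite !mxE.
Qed.

End Filters.

(** Along an ultrafilter a cluster point is a limit, so bounded sequences
    converge and no subsequence has to be extracted. *)
Lemma ultra_bounded_cvg {T : Type} {F : set_system T} (C : R) (u : T -> R) :
  UltraFilter F -> (forall k, `|u k| <= C) -> exists l : R, u k @[k --> F] --> l.
Proof.
move=> FU uC; have FF : ProperFilter F by exact: ultra_proper.
have uF : (u @ F) `[- C, C]%classic.
  by apply: nearW => k; rewrite /= in_itv /= -ler_norml.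
have [l [_ cl]] := @segment_compact R (- C) C (u @ F) _ uF.
exists l => V Vl.
have [//|nV] := in_ultra_setVsetC (u @^-1` V) FU.
by have [x []] := cl (~` V) V nV Vl.
Qed.

Lemma ultra_bounded_cvg_col {T : Type} {F : set_system T} {N : nat} (C : R)
    (u : T -> 'cV[R]_N) :
  UltraFilter F -> (forall k, enorm (u k) <= C) ->
  exists l : 'cV[R]_N, u k @[k --> F] --> l.
Proof.
move=> FU uC.
have /choice [l ul] (i : 'I_N) : exists l : R, u k i 0 @[k --> F] --> l.
  by apply: (ultra_bounded_cvg (C := C)) => k; rewrite (le_trans (abs_entry_le_enorm _ _)).
by exists (\col_i l i); apply/cvg_colP => i; rewrite mxE.
Qed.

(** Dividing by [expR (K * series e n)] turns the quasi-Fejer recursion into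
    plain monotonicity. *)
Lemma quasi_fejer_cvg (a D e : nat -> R) (K : R) :
  (forall n, 0 <= a n) -> (forall n, 0 <= D n) -> cvgn (series e) ->
  (forall n, a n.+1 + D n <= (1 + K * e n) * a n) ->
  cvgn a /\ D n @[n --> \oo] --> 0.
Proof.
move=> a0 D0 ce rec.
have step n : a n.+1 <= expR (K * e n) * a n.
  have := rec n; have := D0 n; have := a0 n; have := expR_ge1Dx (K * e n); nra.
pose c n := expR (- (K * series e n)) * a n.
have noninc : nonincreasing_seq c.
  apply/nonincreasing_seqP => n; rewrite /c seriesSr.
  rewrite mulrDr opprD expRD -mulrA ler_wpM2l ?expR_ge0 //.
  by rewrite expRN ler_pdivrMl ?expR_gt0.
have cc : cvgn c.
  apply: nonincreasing_is_cvgn => //; exists 0 => _ [n _ <-].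
  by rewrite mulr_ge0 ?expR_ge0.
have ca : cvgn a.
  have -> : a = (fun n => expR (K * series e n) * c n).
    by apply/funext => n; rewrite /c mulrA expRxMexpNx_1 mul1r.
  apply: is_cvgM => //; apply/cvg_ex; exists (expR (K * limn (series e))).
  apply: (cvg_comp (fun n => K * series e n) expR); last exact: continuous_expR.
  by apply: cvgM => //; exact: cvg_cst.
split=> //.
have e_0 := cvg_series_cvg_0 ce.
have up : (1 + K * e n) * a n - a n.+1 @[n --> \oo] --> 0.
  rewrite [X in _ --> X](_ : 0 = (1 + K * 0) * limn a - limn a); last first.
    by rewrite mulr0 addr0 mul1r subrr.
  apply: cvgB; last by rewrite (cvg_shiftS a).
  apply: cvgM => //; apply: cvgD; first exact: cvg_cst.
  by apply: cvgM => //; exact: cvg_cst.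
apply: (squeeze_cvgr _ (cvg_cst 0) up); apply: nearW => n; rewrite D0 /=.
by rewrite lerBrDl.
Qed.

End Limits.

(** * Subdifferentials of extended-valued convex functions *)

Section Subdifferential.
Context {R : realType} {N : nat}.
Implicit Types (G : 'cV[R]_N -> \bar R) (x z q : 'cV[R]_N).

Definition subdiff G x : set 'cV[R]_N :=
  [set q | forall z, (G x + (dot q (z - x))%:E <= G z)%E].

Lemma proper_fin_num G x : eproper G -> (G x < +oo)%E -> G x \is a fin_num.
Proof. by move=> [Gny _] Gx; rewrite fin_numE Gny lt_eqF. Qed.

Lemma subdiff_fin_num G x q : eproper G -> subdiff G x q -> G x \is a fin_num.
Proof.
move=> pG qG; apply: proper_fin_num => //; have [_ [z Gz]] := pG.
rewrite ltey; apply/eqP => Gx; have := qG z.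
by rewrite Gx addye ?ltNge // leNgt Gz.
Qed.

(** Add the two subgradient inequalities; properness makes both values finite,
    so that they cancel. *)
Lemma subdiff_monotone G x z q r : eproper G ->
  subdiff G x q -> subdiff G z r -> 0 <= dot (q - r) (x - z).
Proof.
move=> pG qx rz; have := qx z; have := rz x.
rewrite -(fineK (subdiff_fin_num pG qx)) -(fineK (subdiff_fin_num pG rz)).
rewrite -!EFinD !lee_fin dotBl -(opprB x z) dotNr; lra.
Qed.

(** First-order optimality for a minimizer of [G + phi]: along the segment
    towards [z], convexity bounds the increase of [G] linearly, and the
    quadratic upper bound on [phi] is linear up to second order. *)
Lemma subdiff_of_argmin G (phi : 'cV[R]_N -> R) x q (K : R) :
  econvex G -> eproper G -> (G x < +oo)%E ->
  (forall z, (G x + (phi x)%:E <= G z + (phi z)%:E)%E) ->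
  (forall z, phi z <= phi x - dot q (z - x) + K * dot (z - x) (z - x)) ->
  subdiff G x q.
Proof.
move=> cG pG Gx minx upphi z; have Gxf := proper_fin_num pG Gx.
have [->|Gz] := eqVneq (G z) +oo%E; first by rewrite leey.
have Gzf : G z \is a fin_num by apply: proper_fin_num; rewrite ?ltey.
rewrite -(fineK Gxf) -(fineK Gzf) -EFinD lee_fin -subr_ge0.
apply: (@ge0_of_small_quadratic _ _ (K * dot (z - x) (z - x))) => t t01.
have := cG z x t t01; have /andP[t0 t1] := t01.
set w := t *: z + (1 - t) *: x.
have wE : w - x = t *: (z - x).
  by rewrite /w scalerBl scale1r scalerBr addrCA (addrC x) addrK.
rewrite -(fineK Gxf) -(fineK Gzf) -!EFinM -EFinD => Gw.
have Gwf : G w \is a fin_num.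
  by apply: proper_fin_num => //; rewrite (le_lt_trans Gw) // ltry.
move: Gw (minx w) (upphi w); rewrite -(fineK Gwf) -(fineK Gxf) -!EFinD !lee_fin /=.
rewrite wE !(dotZr, dotZl); nra.
Qed.

(** If the inequality failed in the limit, some real level would separate
    [G x] from the limit of the upper bounds of [G (u k)], and lower
    semicontinuity would put [G (u k)] above its own bound. *)
Lemma subdiff_closed {T : Type} {F : set_system T} {FF : ProperFilter F}
    G (u r : T -> 'cV[R]_N) x q :
  eproper G -> lower_semicontinuous G ->
  u k @[k --> F] --> x -> r k @[k --> F] --> q ->
  (forall k, subdiff G (u k) (r k)) -> subdiff G x q.
Proof.
move=> pG lG ux rq sub z.
have [->|Gz] := eqVneq (G z) +oo%E; first by rewrite leey.
have Gzf : G z \is a fin_num by apply: proper_fin_num; rewrite ?ltey.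
rewrite -(fineK Gzf) leNgt; apply/negP => lt.
(* a real level strictly between the limit of the upper bounds and [G x] *)
have [s [s1 s2]] : exists s, fine (G z) - dot q (z - x) < s /\ (s%:E < G x)%E.
  move: lt (pG.1 x); case: (G x) => [b| |] //.
    rewrite -EFinD lte_fin => lt _.
    exists ((fine (G z) - dot q (z - x) + b) / 2); rewrite lte_fin; split; lra.
  by move=> _ _; exists (fine (G z) - dot q (z - x) + 1); rewrite ltry; split=> //; lra.
have [V Vx VG] := lG x s s2.
have bnd : fine (G z) - dot (r k) (z - u k) @[k --> F] --> fine (G z) - dot q (z - x).
  apply: cvgB; first exact: cvg_cst.
  by apply: cvg_dot => //; apply: cvgB => //; exact: cvg_cst.
have near_s : \forall k \near F, fine (G z) - dot (r k) (z - u k) < s.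
  by apply: (cvgr_lt _ bnd).
have near_V : \forall k \near F, V (u k) by exact: ux _ Vx.
have [k [Vk]] := filter_ex (filterI near_V near_s).
apply/negP; rewrite -leNgt; have := sub k z; have := VG _ Vk.
rewrite -(fineK (subdiff_fin_num pG (sub k))) -{1}(fineK Gzf) -EFinD lte_fin lee_fin.
lra.
Qed.

End Subdifferential.

Section SumsOfConvexFunctions.
Context {R : realType}.

(** The complement of the epigraph is open, and contains [(x, s)]. *)
Lemma closed_fun_lsc {N : nat} (g : 'cV[R]_N -> \bar R) :
  closed_fun g -> lower_semicontinuous g.
Proof.
move=> cg x s sx.
have : open (~` [set z : 'cV[R]_N * R | (g z.1 <= z.2%:E)%E]) by exact: closed_openC.
rewrite openE => /(_ (x, s)) /= []; first by apply/negP; rewrite -ltNge.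
move=> [A B] /= [nA nB] AB; exists A => // z Az.
have := AB (z, s); rewrite /= => /(_ (conj Az (nbhs_singleton nB))).
by move/negP; rewrite -ltNge.
Qed.

(** A real level below the sum splits into real levels below the two summands,
    because neither of them is [-oo]. *)
Lemma lsc_add {X : topologicalType} (g h : X -> \bar R) :
  (forall x, g x != -oo%E) -> (forall x, h x != -oo%E) ->
  lower_semicontinuous g -> lower_semicontinuous h ->
  lower_semicontinuous (fun x => g x + h x)%E.
Proof.
move=> gy hy lg lh x s sx.
have [s1 [s2 [h1 h2 h12]]] : exists s1 s2,
    [/\ (s1%:E < g x)%E, (s2%:E < h x)%E & s <= s1 + s2].
  move: sx (gy x) (hy x); case: (g x) => [a| |] //; case: (h x) => [b| |] // + _ _.
  - rewrite -EFinD lte_fin => sab.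
    exists (a - (a + b - s) / 2), (b - (a + b - s) / 2).
    by split; rewrite ?lte_fin; lra.
  - by move=> _; exists (a - 1), (s - a + 1); split; rewrite ?lte_fin ?ltry //; lra.
  - by move=> _; exists (s - b + 1), (b - 1); split; rewrite ?lte_fin ?ltry //; lra.
  - by move=> _; exists s, 0; split; rewrite ?ltry //; lra.
have [V Vx Vg] := lg _ _ h1; have [V' Vx' Vh] := lh _ _ h2.
exists (V `&` V'); first exact: filterI.
move=> y [Vy Vy']; apply: (@le_lt_trans _ _ (s1 + s2)%:E); first by rewrite lee_fin.
by rewrite EFinD lteD // ?Vg ?Vh.
Qed.

Lemma sum_neq_ninfty {I : Type} (r : seq I) (a : I -> \bar R) :
  (forall i, a i != -oo%E) -> (\sum_(i <- r) a i)%E != -oo%E.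
Proof.
move=> ay; elim/big_rec: _ => // i b _ by_.
by rewrite adde_eq_ninfty negb_or ay.
Qed.

Lemma lsc_sum {X : topologicalType} {I : Type} (r : seq I) (g : I -> X -> \bar R) :
  (forall i x, g i x != -oo%E) -> (forall i, lower_semicontinuous (g i)) ->
  lower_semicontinuous (fun x => \sum_(i <- r) g i x)%E.
Proof.
move=> gy lg; elim: r => [|i r IH].
  move=> x s; rewrite big_nil => s0; exists setT; first exact: filterT.
  by move=> y _; rewrite big_nil.
rewrite (_ : (fun _ => _) = (fun x => g i x + \sum_(j <- r) g j x)%E).
  by apply: lsc_add => // x; exact: sum_neq_ninfty.
by apply/funext => x; rewrite big_cons.
Qed.

Lemma lsc_comp {X Y : topologicalType} (g : Y -> \bar R) (l : X -> Y) :
  continuous l -> lower_semicontinuous g -> lower_semicontinuous (g \o l).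
Proof.
move=> cl lg x s /= sx; have [V Vx Vg] := lg _ _ sx.
by exists (l @^-1` V); [exact: cl|move=> y /Vg].
Qed.

Lemma econvex_sum {N : nat} {I : Type} (r : seq I) (g : I -> 'cV[R]_N -> \bar R) :
  (forall i x, g i x != -oo%E) -> (forall i, econvex (g i)) ->
  econvex (fun x => \sum_(i <- r) g i x)%E.
Proof.
move=> gy cg x y t t01; elim: r => [|i r IH].
  by rewrite !big_nil !mule0 adde0.
have sy z : (\sum_(j <- r) g j z)%E != -oo%E by exact: sum_neq_ninfty.
have dd (u v : \bar R) : u != -oo%E -> v != -oo%E -> (u +? v)%E.
  by case: u => [?| |] //; case: v => [?| |].
rewrite !big_cons !muleDr ?dd //.
by rewrite addeACA; apply: leeD => //; exact: cg.
Qed.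

End SumsOfConvexFunctions.

Section QuadraticProx.
Context {R : realType} {N : nat}.

Lemma sqnorm_wrtD (H : 'M[R]_N) (u v : 'cV[R]_N) : H^T = H ->
  sqnorm_wrt H (u + v) = sqnorm_wrt H u + 2 * dot (H *m u) v + sqnorm_wrt H v.
Proof.
move=> Hsym; rewrite /sqnorm_wrt mulmxDr !(dotDl, dotDr) (dot_mulmx H u v) Hsym.
by rewrite (dotC v); ring.
Qed.

Lemma quadratic_bounded (H : 'M[R]_N) :
  exists K, forall u, sqnorm_wrt H u <= K * dot u u.
Proof.
have [C C0 hC] := mulmx_dot_bounded H; exists (1 + C) => u.
have := young u (H *m u) ltr01; have := hC u; have := dot_ge0 u.
rewrite /sqnorm_wrt invr1; have := dot_ge0 (H *m u); lra.
Qed.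

(** Covers both updates of the method: the proximal step, with [b = 0], and the
    dual step, with [G = 0]. *)
Lemma subdiff_of_quadratic_argmin (G phi : 'cV[R]_N -> \bar R) (H : 'M[R]_N)
    (v b x : 'cV[R]_N) : H^T = H -> econvex G -> eproper G ->
  (forall z, phi z = G z + (2^-1 * sqnorm_wrt H (z - v) - dot b z)%:E)%E ->
  argmin phi x -> subdiff G x (b - H *m (x - v)).
Proof.
move=> Hsym cG pG phiE [phix minx]; have [K hK] := quadratic_bounded H.
pose h z := 2^-1 * sqnorm_wrt H (z - v) - dot b z.
apply: (@subdiff_of_argmin _ _ G h x _ (K / 2)) => //.
- move: phix; rewrite phiE; by case: (G x) => [r| |] // _; exact: ltry.
- by move=> z; rewrite -!phiE.
move=> z; rewrite /h.
have -> : z - v = (x - v) + (z - x) by rewrite [RHS]addrC addrA subrK.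
rewrite (sqnorm_wrtD (x - v)) // (dotBl b) (dotBr b z x).
have := hK (z - x); lra.
Qed.

End QuadraticProx.

(** * Convergence of a primal-dual iteration *)

Section PrimalDualIteration.
Context {R : realType} {N M : nat}.
Variables (G : 'cV[R]_N -> \bar R) (gF : 'cV[R]_N -> 'cV[R]_N).
Variables (P Gam : 'M[R]_N) (Q : 'M[R]_M) (B : 'M[R]_(M, N)) (c lip : R).

(** The optimality system of the saddle-point problem for the Lagrangian
    [F x + G x + dot y (B *m x)]. *)
Definition kkt (xs : 'cV[R]_N) (ys : 'cV[R]_M) : Prop :=
  subdiff G xs (- gF xs - B^T *m ys) /\ B *m xs = 0.

Hypotheses (c0 : 0 < c) (pG : eproper G) (lG : lower_semicontinuous G).
Hypotheses (Psym : P^T = P) (Qsym : Q^T = Q) (PGam : P *m Gam = 1%:M).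
Hypothesis Qbig : forall z : 'cV[R]_M,
  dot (B^T *m z) (Gam *m (B^T *m z)) + c * dot z z <= dot z (Q *m z).
(** A forward step evaluates [gF] at [x] but the monotonicity argument tests it
    at [u]; the mismatch has to be absorbed by the metric [P], uniformly by
    [c]. *)
Hypothesis gF_mono : forall x u s : 'cV[R]_N,
  c * dot (x - u) (x - u)
    <= dot (x - u) (P *m (x - u)) + 2 * dot (u - s) (gF x - gF s).
Hypothesis gF_lip : forall x z : 'cV[R]_N,
  dot (gF x - gF z) (gF x - gF z) <= lip * dot (x - z) (x - z).

Lemma P_coercive v : c * dot v v <= dot v (P *m v).
Proof. by have := gF_mono v 0 0; rewrite !subr0 dot0l mulr0 addr0. Qed.

Lemma Gam_ge0 v : 0 <= dot v (Gam *m v).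
Proof.
have {1}-> : v = P *m (Gam *m v) by rewrite mulmxA PGam mul1mx.
by rewrite dotC; apply: le_trans (P_coercive _); rewrite mulr_ge0 ?dot_ge0 // ltW.
Qed.

Lemma Q_coercive z : c * dot z z <= dot z (Q *m z).
Proof. by apply: le_trans (Qbig z); rewrite lerDr Gam_ge0. Qed.

Section Run.
Variables (xt x d : nat -> 'cV[R]_N) (y : nat -> 'cV[R]_M) (e : nat -> R).
Hypothesis xt_step : forall k, subdiff G (xt k.+1)
  (P *m (x k - xt k.+1) - gF (x k) - B^T *m y k + d k).
Hypothesis y_step : forall k, Q *m (y k.+1 - y k) = B *m xt k.+1.
Hypothesis x_step : forall k,
  x k.+1 = xt k.+1 + Gam *m (B^T *m (y k - y k.+1)).
Hypotheses (e_ge0 : forall k, 0 <= e k) (e_summable : cvgn (series e)).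
Hypothesis d_le : forall k, enorm (d k) <= e k.

(** The squared distance of the k-th iterate to [(xs, ys)] in the metric
    [diag(P, Q)]. *)
Definition sqdist xs ys k : R :=
  dot (x k - xs) (P *m (x k - xs)) + dot (y k - ys) (Q *m (y k - ys)).

(** Monotonicity of the subdifferential at [xt k.+1] and [xs], in which
    [B^T *m y k] is traded for [B^T *m y k.+1] by means of [x_step] and
    [y_step]. The correction [Gam *m (B^T *m (y k - y k.+1))] in [x_step] is
    what makes the cross terms between primal and dual increments cancel, up to
    the square [B *m Gam *m B^T] dominated by [Q]. *)
Lemma fejer_step xs ys k : kkt xs ys ->
  sqdist xs ys k.+1 + c * dot (x k - xt k.+1) (x k - xt k.+1)
    + c * dot (y k - y k.+1) (y k - y k.+1)
  <= sqdist xs ys k + 2 * dot (xt k.+1 - xs) (d k).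
Proof.
move=> [sub_s Bxs]; rewrite /sqdist.
have mono := subdiff_monotone pG (xt_step k) sub_s.
have mixed := gF_mono (x k) (xt k.+1) xs.
have /= Qq := Qbig (y k - y k.+1).
have ystep := y_step k.
rewrite x_step.
set a := x k - xs; set u := xt k.+1 - xs; set h := y k - ys.
set q := y k - y k.+1 in Qq *; set b := B^T *m q in Qq *.
have au : x k - xt k.+1 = a - u by rewrite /a /u opprB addrA subrK.
have hq : y k.+1 - ys = h - q by rewrite /h /q opprB [RHS]addrC addrA subrK.
have {ystep} Bu : B *m u = - (Q *m q).
  by rewrite /u mulmxBr Bxs subr0 -ystep -mulmxN /q opprB.
have -> : xt k.+1 + Gam *m b - xs = u + Gam *m b by rewrite addrAC.
rewrite au hq in mono mixed *.
have wP : dot (Gam *m b) (P *m u) = dot b u.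
  by rewrite dot_mulmx Psym mulmxA PGam mul1mx.
have bE z : dot b z = dot q (B *m z) by rewrite dot_mulmx.
have hQq : dot q (Q *m h) = - dot h (B *m u).
  by rewrite dot_mulmx Qsym Bu dotNr opprK dotC.
move: mono; rewrite (_ : P *m (a - u) - _ - _ + d k - _ =
   P *m (a - u) - (gF (x k) - gF xs) - B^T *m h + d k); last first.
  rewrite /h (mulmxBr _ (y k)); move: (P *m (a - u)) (B^T *m y k) (B^T *m ys) => v1 v2 v3.
  apply/matrixP => i j; rewrite !mxE; ring.
have Bhu : dot (B^T *m h) u = dot h (B *m u) by rewrite dot_mulmx.
have bqu : dot b u = - dot q (Q *m q) by rewrite bE Bu dotNr.
have uPa : dot u (P *m a) = dot a (P *m u) by rewrite dot_mulmx Psym dotC.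
rewrite (dotDl _ (d k)) (dotBl _ (B^T *m h)) (dotBl (P *m (a - u))) Bhu.
rewrite (mulmxDr P u) (mulmxA P) PGam mul1mx (dotDr _ (P *m u)) (dotDl u) (dotDl u _ b).
rewrite wP (dotC u b) bqu.
rewrite (dotC (P *m _) u) (dotC (d k)) (dotC (gF _ - _)).
move: Qq mixed; rewrite -/b (dotC (Gam *m b)) (mulmxBr P a u) (mulmxBr Q h q) -/u.
rewrite !(dotBl a u) !(dotBr _ (P *m a) (P *m u)) (dotBl h q).
rewrite !(dotBr _ (Q *m h) (Q *m q)) hQq uPa.
have -> : dot h (Q *m q) = - dot h (B *m u) by rewrite Bu dotNr opprK.
clearbody a u h q b; lra.
Qed.

Lemma sqdist_ge0 xs ys k : 0 <= sqdist xs ys k.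
Proof.
rewrite addr_ge0 //; [apply: le_trans (P_coercive _)|apply: le_trans (Q_coercive _)].
all: by rewrite mulr_ge0 ?dot_ge0 // ltW.
Qed.

Lemma sqdist_coercive xs ys k :
  c * (dot (x k - xs) (x k - xs) + dot (y k - ys) (y k - ys)) <= sqdist xs ys k.
Proof. by rewrite mulrDr lerD // ?P_coercive ?Q_coercive. Qed.

Lemma e_le k : e k <= limn (series e).
Proof.
have nd : nondecreasing_seq (series e).
  by apply/nondecreasing_seqP => n; rewrite seriesSr lerDl.
apply: le_trans (nondecreasing_cvgn_le nd e_summable k.+1).
rewrite seriesSr lerDr; elim: k => [|k IH]; first by rewrite /series /= big_geq.
by rewrite seriesSr addr_ge0.
Qed.

(** Writing [xt k.+1 - xs] as [(x k - xs) - (x k - xt k.+1)], the first part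
    costs a factor [1 + O(e k)] on the distance, and the second one half of the
    decrease gained in [fejer_step]. The bound [e k <= limn (series e)] makes
    [e k ^+ 2] a multiple of [e k]. *)
Lemma error_term_le xs ys k :
  2 * dot (xt k.+1 - xs) (d k) <=
    (1 + c^-1 + 2 / c * limn (series e)) * e k * (sqdist xs ys k + 1)
    + c / 2 * dot (x k - xt k.+1) (x k - xt k.+1).
Proof.
have -> : xt k.+1 - xs = - (x k - xt k.+1) + (x k - xs).
  by rewrite opprB addrA subrK.
rewrite (dotDl (- (x k - xt k.+1))) (dotNl (x k - xt k.+1)).
set r := x k - xt k.+1; set a := x k - xs.
have dd : dot (d k) (d k) <= e k ^+ 2 by rewrite -enorm_le.
have c2 : 0 < c / 2 by rewrite divr_gt0.
have h1 : - (2 * dot r (d k)) <= c / 2 * dot r r + 2 / c * (e k * limn (series e)).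
  have := young (- r) (d k) c2; rewrite !dotNl dotNr opprK invf_div mulrN.
  move/le_trans; apply; rewrite lerD2l ler_wpM2l ?divr_ge0 ?(ltW c0) //.
  by rewrite (le_trans dd) // expr2 ler_wpM2l // e_le.
have h2 : 2 * dot a (d k) <= e k * (1 + dot a a).
  have hd : enorm a * enorm (d k) <= enorm a * e k by rewrite ler_wpM2l ?enorm_ge0.
  have he : 0 <= e k * (1 - enorm a) ^+ 2 by rewrite mulr_ge0 // sqr_ge0.
  have := cauchy_schwarz a (d k); rewrite -(sqr_enorm a); clearbody a; lra.
have h3 : dot a a <= c^-1 * sqdist xs ys k.
  rewrite ler_pdivlMl // (le_trans _ (sqdist_coercive _ _ _)) //.
  by rewrite ler_pM2l // lerDl dot_ge0.
have h4 : e k * (1 + dot a a) <= e k * (1 + c^-1 * sqdist xs ys k).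
  by rewrite ler_wpM2l // lerD2l.
have E0 : 0 <= limn (series e) by apply: le_trans (e_le k).
have s0 := sqdist_ge0 xs ys k; have ci : 0 < c^-1 by rewrite invr_gt0.
have m1 : 0 <= 2 / c * limn (series e) * e k * sqdist xs ys k.
  by rewrite !mulr_ge0 // ltW.
have m2 : 0 <= e k * sqdist xs ys k by rewrite mulr_ge0.
have m3 : 0 <= e k * c^-1 by rewrite mulr_ge0 // ltW.
clearbody a r; lra.
Qed.

(** [quasi_fejer_cvg] applies to [sqdist xs ys k + 1]: the added 1 turns the
    additive error into a multiplicative one. *)
Lemma kkt_sqdist_cvg xs ys : kkt xs ys ->
  [/\ cvgn (sqdist xs ys),
      dot (x k - xt k.+1) (x k - xt k.+1) @[k --> \oo] --> 0 &
      dot (y k - y k.+1) (y k - y k.+1) @[k --> \oo] --> 0].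
Proof.
move=> ws.
pose K := 1 + c^-1 + 2 / c * limn (series e).
pose D k := c / 2 * dot (x k - xt k.+1) (x k - xt k.+1)
            + c * dot (y k - y k.+1) (y k - y k.+1).
have c2 : 0 < c / 2 by rewrite divr_gt0.
have D0 k : 0 <= D k by rewrite addr_ge0 // mulr_ge0 ?dot_ge0 // ltW.
have a0 k : 0 <= sqdist xs ys k + 1 by rewrite addr_ge0 ?sqdist_ge0.
have rec k : sqdist xs ys k.+1 + 1 + D k <= (1 + K * e k) * (sqdist xs ys k + 1).
  have := fejer_step k ws; have := error_term_le xs ys k.
  rewrite -/K /D; lra.
have [ca cD] := quasi_fejer_cvg a0 D0 e_summable rec.
split.
- rewrite (_ : sqdist xs ys = (fun k => (sqdist xs ys k + 1) - 1)).
    by apply: is_cvgB => //; exact: is_cvg_cst.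
  by apply/funext => k; rewrite addrK.
- have cD' : (c / 2)^-1 * D k @[k --> \oo] --> 0.
    by rewrite -(mulr0 (c / 2)^-1); apply: cvgM => //; exact: cvg_cst.
  apply: (squeeze_cvgr _ (cvg_cst 0) cD'); apply: nearW => k.
  by rewrite dot_ge0 /= ler_pdivlMl // lerDl mulr_ge0 ?dot_ge0 // ltW.
- have cD' : c^-1 * D k @[k --> \oo] --> 0.
    by rewrite -(mulr0 c^-1); apply: cvgM => //; exact: cvg_cst.
  apply: (squeeze_cvgr _ (cvg_cst 0) cD'); apply: nearW => k.
  by rewrite dot_ge0 /= ler_pdivlMl // lerDr mulr_ge0 ?dot_ge0 // ltW.
Qed.

Lemma cvgn_bounded (u : nat -> R) : cvgn u -> exists2 C, 0 <= C & forall k, u k <= C.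
Proof.
move=> /cvg_seq_bounded [C [_ /(_ (`|C| + 1))]] h.
exists (`|C| + 1) => [|k]; first by rewrite addr_ge0.
by rewrite (le_trans (ler_norm _)) // h // (le_lt_trans (ler_norm _)) // ltrDl.
Qed.

Lemma kkt_bounded xs ys : kkt xs ys ->
  exists C, forall k,
    [/\ enorm (x k - xs) <= C, enorm (y k - ys) <= C & enorm (xt k.+1 - xs) <= C].
Proof.
move=> ws; have [ca /cvgP/cvgn_bounded [C1 C10 hC1] _] := kkt_sqdist_cvg ws.
have [C2 C20 hC2] := cvgn_bounded ca.
pose C3 := Num.sqrt (c^-1 * C2); pose C4 := Num.sqrt C1.
have cC2 : 0 <= c^-1 * C2 by rewrite mulr_ge0 // invr_ge0 ltW.
have C30 : 0 <= C3 by exact: sqrtr_ge0.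
have C40 : 0 <= C4 by exact: sqrtr_ge0.
have bxy k : dot (x k - xs) (x k - xs) + dot (y k - ys) (y k - ys) <= C3 ^+ 2.
  by rewrite sqr_sqrtr // ler_pdivlMl // (le_trans (sqdist_coercive _ _ _)).
have bx k : enorm (x k - xs) <= C3.
  by rewrite enorm_le // (le_trans _ (bxy k)) // lerDl dot_ge0.
have by_ k : enorm (y k - ys) <= C3.
  by rewrite enorm_le // (le_trans _ (bxy k)) // lerDr dot_ge0.
exists (C3 + C4) => k; split.
- by rewrite (le_trans (bx k)) // lerDl.
- by rewrite (le_trans (by_ k)) // lerDl.
have -> : xt k.+1 - xs = (x k - xs) - (x k - xt k.+1).
  by rewrite opprB [RHS]addrC addrA subrK.
rewrite (le_trans (enormD _ _)) // enormN lerD //.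
by rewrite enorm_le // sqr_sqrtr.
Qed.

(** Opial's argument: a limit point along an ultrafilter satisfies the
    optimality system, and the distance to it, which converges, can only
    converge to 0. *)
Theorem primal_dual_cvg : (exists xs ys, kkt xs ys) ->
  exists xs ys, [/\ kkt xs ys, x k @[k --> \oo] --> xs & y k @[k --> \oo] --> ys].
Proof.
move=> [xs [ys ws]].
have [_ xxt yy] := kkt_sqdist_cvg ws.
have [C hC] := kkt_bounded ws.
have [U [UU ooU]] := @ultraFilterLemma nat \oo _.
have FU : ProperFilter U by exact: ultra_proper.
have toU (V : topologicalType) (u : nat -> V) (l : V) :
    u k @[k --> \oo] --> l -> u k @[k --> U] --> l.
  by move=> ul A /ul; exact: ooU.
have [lx hlx] := @ultra_bounded_cvg_col _ _ U _ C (fun k => x k - xs) UU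
  (fun k => let: And3 h _ _ := hC k in h).
have [ly hly] := @ultra_bounded_cvg_col _ _ U _ C (fun k => y k - ys) UU
  (fun k => let: And3 _ h _ := hC k in h).
pose xl := lx + xs; pose yl := ly + ys.
have xU : x k @[k --> U] --> xl.
  rewrite (_ : x = fun k => (x k - xs) + xs); last by apply/funext => k; rewrite subrK.
  by apply: cvgD => //; exact: cvg_cst.
have yU : y k @[k --> U] --> yl.
  rewrite (_ : y = fun k => (y k - ys) + ys); last by apply/funext => k; rewrite subrK.
  by apply: cvgD => //; exact: cvg_cst.
have xxtU : x k - xt k.+1 @[k --> U] --> (0 : 'cV[R]_N).
  by apply/cvg_sqdistP; under eq_cvg do rewrite subr0; exact: toU.
have yyU : y k - y k.+1 @[k --> U] --> (0 : 'cV[R]_M).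
  by apply/cvg_sqdistP; under eq_cvg do rewrite subr0; exact: toU.
have xtU : xt k.+1 @[k --> U] --> xl.
  rewrite (_ : (fun k => xt k.+1) = fun k => x k - (x k - xt k.+1)); last first.
    by apply/funext => k; rewrite opprB addrC subrK.
  by rewrite -(subr0 xl); exact: (cvgB xU xxtU).
have gU : gF (x k) @[k --> U] --> gF xl.
  apply/cvg_sqdistP.
  have up : lip * dot (x k - xl) (x k - xl) @[k --> U] --> 0.
    by rewrite -(mulr0 lip); apply: cvgM; [exact: cvg_cst|exact/cvg_sqdistP].
  apply: (squeeze_cvgr _ (cvg_cst 0) up); apply: nearW => k.
  by rewrite dot_ge0 /= gF_lip.
have dU : d k @[k --> U] --> (0 : 'cV[R]_N).
  apply/cvg_sqdistP; under eq_cvg do rewrite subr0.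
  have eU : e k * e k @[k --> U] --> 0.
    rewrite -(mulr0 0); have e_0 := toU _ _ _ (cvg_series_cvg_0 e_summable).
    exact: cvgM.
  apply: (squeeze_cvgr _ (cvg_cst 0) eU); apply: nearW => k.
  by rewrite dot_ge0 /= -expr2 -enorm_le.
have wl : kkt xl yl.
  split.
    have rU : P *m (x k - xt k.+1) - gF (x k) - B^T *m y k + d k @[k --> U]
        --> P *m 0 - gF xl - B^T *m yl + 0.
      exact: (cvgD (cvgB (cvgB (cvg_mulmx xxtU) gU) (cvg_mulmx yU)) dU).
    rewrite mulmx0 sub0r addr0 in rU.
    exact: (subdiff_closed pG lG xtU rU xt_step).
  have BU : B *m xt k.+1 @[k --> U] --> B *m xl by exact: cvg_mulmx.
  have BU0 : B *m xt k.+1 @[k --> U] --> (0 : 'cV[R]_M).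
    rewrite (_ : (fun k => B *m xt k.+1) = fun k => - Q *m (y k - y k.+1)).
      by rewrite -(mulmx0 _ (- Q)); exact: (cvg_mulmx yyU).
    by apply/funext => k; rewrite -y_step mulNmx -mulmxN opprB.
  exact: (cvg_unique (@norm_hausdorff _ _) BU BU0).
have [/cvg_ex [l dl] _ _] := kkt_sqdist_cvg wl.
have dU0 : sqdist xl yl k @[k --> U] --> 0.
  have xU0 : x k - xl @[k --> U] --> (0 : 'cV[R]_N).
    by rewrite -(subrr xl); exact: (cvgB xU (cvg_cst _)).
  have yU0 : y k - yl @[k --> U] --> (0 : 'cV[R]_M).
    by rewrite -(subrr yl); exact: (cvgB yU (cvg_cst _)).
  rewrite (_ : 0 = dot (0 : 'cV[R]_N) (P *m 0) + dot (0 : 'cV[R]_M) (Q *m 0)).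
    exact: (cvgD (cvg_dot xU0 (cvg_mulmx xU0)) (cvg_dot yU0 (cvg_mulmx yU0))).
  by rewrite !dot0l addr0.
have l0 : l = 0 by apply: (cvg_unique (@norm_hausdorff _ _) (toU _ _ _ dl) dU0).
rewrite l0 in dl.
have cd : c^-1 * sqdist xl yl k @[k --> \oo] --> 0.
  by rewrite -(mulr0 c^-1); apply: cvgM => //; exact: cvg_cst.
exists xl, yl; split; first exact: wl.
all: apply/cvg_sqdistP.
all: apply: (squeeze_cvgr _ (cvg_cst 0) cd); apply: nearW => k.
all: rewrite dot_ge0 /= ler_pdivlMl // (le_trans _ (sqdist_coercive _ _ _)) //.
all: by rewrite ler_pM2l // ?lerDl ?lerDr dot_ge0.
Qed.

End Run.
End PrimalDualIteration.

Section SaddlePoints.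
Context {R : realType} {N M : nat}.
Variables (F : 'cV[R]_N -> R) (gF : 'cV[R]_N -> 'cV[R]_N).
Variables (G : 'cV[R]_N -> \bar R) (B : 'M[R]_(M, N)) (K : R).
Hypotheses (cG : econvex G) (pG : eproper G).
Hypothesis F_ge : forall x z, F x + dot (gF x) (z - x) <= F z.
Hypothesis F_le : forall x z,
  F z <= F x + dot (gF x) (z - x) + K * dot (z - x) (z - x).

Let L x y : \bar R := ((F x)%:E + G x + (dot y (B *m x))%:E)%E.

(** Maximality in [y] makes [B *m xs] orthogonal to everything, and minimality
    in [x] is first-order optimality; the converse is convexity of [F]. *)
Lemma saddle_kktP xs ys :
  (forall x y, (L xs y <= L xs ys)%E /\ (L xs ys <= L x ys)%E) <->
  kkt G gF B xs ys.
Proof.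
rewrite /L; split=> [sad|[sub Bxs] x y]; last first.
  rewrite Bxs !dot0r; split=> //.
  have := sub x; rewrite dotBl dotNl -dot_mulmx mulmxBr Bxs subr0.
  have := subdiff_fin_num pG sub; case: (G xs) => [r _| |] //.
  case: (G x) => [s| |] //.
    by rewrite -!EFinD !lee_fin; have := F_ge xs x; lra.
  by move=> _; rewrite addey // addye // leey.
have Gxs : (G xs < +oo)%E.
  have [_ [z Gz]] := pG; have := (sad z ys).2; have := pG.1 z; move: Gz.
  by case: (G xs) => [r| |]; case: (G z) => [s| |] // *; rewrite ltry.
have Gf := proper_fin_num pG Gxs.
have Bxs : B *m xs = 0.
  have := (sad xs (ys + B *m xs)).1; rewrite -(fineK Gf) -!EFinD lee_fin dotDl.
  rewrite lerD2l gerDl => h; apply: dot_eq0; apply/eqP.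
  by rewrite eq_le h dot_ge0.
split=> //.
apply: (@subdiff_of_argmin _ _ G (fun z => F z + dot ys (B *m z)) xs _ K) => //.
  by move=> z; have := (sad z ys).2; rewrite !EFinD -!addeA !(addeCA (G _)).
move=> z; have := F_le xs z.
by rewrite (dotBl (- gF xs)) (dotNl (gF xs)) -(dot_mulmx B) mulmxBr (dotBr ys); lra.
Qed.

End SaddlePoints.

(** * Square roots of positive semidefinite matrices *)

Section SquareRootExistence.
Context {R : realType} {N : nat}.

(** With [s = 1] and [s = -1], nonnegativity of the left-hand side bounds the
    quadratic form of a symmetric matrix with nonnegative entries by its row
    sums, from below and from above. *)
Lemma sum_weighted_sqr (Y : 'M[R]_N) (s : R) (z : 'cV[R]_N) : Y^T = Y ->
  \sum_i \sum_j Y i j * (z i 0 + s * z j 0) ^+ 2 =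
  (1 + s ^+ 2) * (\sum_i (\sum_j Y i j) * z i 0 ^+ 2) + 2 * s * dot z (Y *m z).
Proof.
move=> Ysym.
have e1 : \sum_i \sum_j Y i j * z i 0 ^+ 2 = \sum_i (\sum_j Y i j) * z i 0 ^+ 2.
  by apply: eq_bigr => i _; rewrite mulr_suml.
have e2 : \sum_i \sum_j Y i j * z j 0 ^+ 2 = \sum_i (\sum_j Y i j) * z i 0 ^+ 2.
  rewrite exchange_big -e1; apply: eq_bigr => i _; apply: eq_bigr => j _.
  by rewrite -{1}Ysym mxE.
have e3 : dot z (Y *m z) = \sum_i \sum_j Y i j * (z i 0 * z j 0).
  apply: eq_bigr => i _; rewrite mxE mulr_sumr; apply: eq_bigr => j _; ring.
rewrite mulrDl mul1r -{1}e1 -e2 e3 !mulr_sumr -!big_split; apply: eq_bigr => i _ /=.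
rewrite !mulr_sumr -!big_split; apply: eq_bigr => j _ /=; ring.
Qed.

Lemma weighted_sqr_ge0 (Y : 'M[R]_N) (s : R) (z : 'cV[R]_N) :
  (forall i j, 0 <= Y i j) ->
  0 <= \sum_i \sum_j Y i j * (z i 0 + s * z j 0) ^+ 2.
Proof.
move=> Y0; apply: sumr_ge0 => i _; apply: sumr_ge0 => j _.
by rewrite mulr_ge0 ?sqr_ge0.
Qed.

Section Iteration.
Variable T : 'M[R]_N.
Hypotheses (Tsym : T^T = T) (T0 : forall i j, 0 <= T i j).
Hypothesis Tsum : forall i, \sum_j T i j <= 1.

(** The limit [Y] satisfies [2 Y = T + Y ^ 2], that is,
    [(1 - Y) ^ 2 = 1 - T]. *)
Fixpoint sqrt_iter k : 'M[R]_N :=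
  if k is k'.+1 then 2^-1 *: (T + sqrt_iter k' *m sqrt_iter k') else 0.

Lemma sqrt_iterE k i j : sqrt_iter k.+1 i j =
  2^-1 * (T i j + \sum_l sqrt_iter k i l * sqrt_iter k l j).
Proof. by rewrite /= !mxE. Qed.

Lemma sqrt_iter_ge0 k i j : 0 <= sqrt_iter k i j.
Proof.
elim: k i j => [|k IH] i j; first by rewrite mxE.
rewrite sqrt_iterE mulr_ge0 ?invr_ge0 // addr_ge0 // sumr_ge0 // => l _.
exact: mulr_ge0.
Qed.

Lemma sqrt_iter_nondecreasing k i j : sqrt_iter k i j <= sqrt_iter k.+1 i j.
Proof.
elim: k i j => [|k IH] i j; first by rewrite mxE sqrt_iter_ge0.
rewrite (sqrt_iterE k i j) (sqrt_iterE k.+1 i j) ler_pM2l ?invr_gt0 // lerD2l.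
by apply: ler_sum => l _; apply: ler_pM; rewrite ?sqrt_iter_ge0.
Qed.

Lemma sqrt_iter_sum_le1 k i : \sum_j sqrt_iter k i j <= 1.
Proof.
elim: k i => [|k IH] i; first by rewrite big1 // => j _; rewrite mxE.
under eq_bigr do rewrite sqrt_iterE.
rewrite -mulr_sumr big_split /= ler_pdivrMl // mulr1.
rewrite [leRHS](_ : _ = 1 + 1) // lerD // exchange_big /=.
apply: le_trans (IH i); apply: ler_sum => l _.
by rewrite -mulr_sumr ler_piMr ?sqrt_iter_ge0.
Qed.

Lemma sqrt_iter_sym k : (sqrt_iter k)^T = sqrt_iter k.
Proof.
elim: k => [|k IH]; first by rewrite trmx0.
by rewrite /= linearZ linearD /= trmx_mul Tsym !IH.
Qed.

Lemma sqrt_iter_cvg i j : cvgn (fun k => sqrt_iter k i j).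
Proof.
apply: nondecreasing_is_cvgn.
  by apply/nondecreasing_seqP => k; exact: sqrt_iter_nondecreasing.
exists 1 => _ [k _ <-]; apply: le_trans (sqrt_iter_sum_le1 k i).
by rewrite (bigD1 j) //= lerDl sumr_ge0 // => l _; exact: sqrt_iter_ge0.
Qed.

(** The iterates increase entrywise and their row sums stay at most 1, so they
    converge entrywise. The row sums of the limit [Y] are at most 1, which
    makes [1 - Y] positive semidefinite. *)
Theorem psd_sqrt_one_sub : exists S : 'M[R]_N, psd S /\ S *m S = 1%:M - T.
Proof.
pose Y : 'M[R]_N := \matrix_(i, j) limn (fun k => sqrt_iter k i j).
have cY i j : sqrt_iter k i j @[k --> \oo] --> Y i j.
  by rewrite mxE; exact: sqrt_iter_cvg.
have Ysym : Y^T = Y.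
  apply/matrixP => i j; rewrite !mxE; congr (limn _); apply/funext => k.
  by rewrite -{1}sqrt_iter_sym mxE.
have Y0 i j : 0 <= Y i j.
  rewrite mxE; apply: limr_ge; first exact: sqrt_iter_cvg.
  by apply: nearW => k; exact: sqrt_iter_ge0.
have Ysum i : \sum_j Y i j <= 1.
  have c : \sum_j sqrt_iter k i j @[k --> \oo] --> \sum_j Y i j.
    by apply: cvg_sumr => j.
  rewrite -(cvg_lim _ c) //; apply: limr_le; first exact: cvgP c.
  by apply: nearW => k; exact: sqrt_iter_sum_le1.
have Yeq : Y + Y = T + Y *m Y.
  apply/matrixP => i j; rewrite [LHS]mxE [RHS]mxE [(Y *m Y) _ _]mxE.
  have c : 2^-1 * (T i j + \sum_l sqrt_iter k i l * sqrt_iter k l j) @[k --> \oo]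
      --> 2^-1 * (T i j + \sum_l Y i l * Y l j).
    apply: cvgM; first exact: cvg_cst.
    apply: cvgD; first exact: cvg_cst.
    by apply: cvg_sumr => l; exact: cvgM.
  have c' : sqrt_iter k.+1 i j @[k --> \oo] --> Y i j.
    by rewrite (cvg_shiftS (fun k => sqrt_iter k i j)).
  have stepE : (fun k => sqrt_iter k.+1 i j) =
      (fun k => 2^-1 * (T i j + \sum_l sqrt_iter k i l * sqrt_iter k l j)).
    by apply/funext => k; rewrite sqrt_iterE.
  rewrite stepE in c'.
  have YE : Y i j = 2^-1 * (T i j + \sum_l Y i l * Y l j).
    exact: (cvg_unique (@norm_hausdorff _ _) c' c).
  lra.
exists (1%:M - Y); split; last first.
  have YY : Y *m Y = Y + Y - T by rewrite Yeq addrAC subrr add0r.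
  rewrite mulmxBl mul1mx mulmxBr mulmx1 YY; clear -R.
  by move: Y => Y; apply/matrixP => i j; rewrite !mxE; ring.
split; first by rewrite linearB /= trmx1 Ysym.
move=> z; rewrite mulmxBl mul1mx dotBr subr_ge0.
have := weighted_sqr_ge0 (-1) z Y0; rewrite sum_weighted_sqr // sqrrN expr1n.
have : \sum_i (\sum_j Y i j) * z i 0 ^+ 2 <= dot z z.
  by apply: ler_sum => i _; rewrite -expr2 ler_piMl ?sqr_ge0.
lra.
Qed.

End Iteration.
End SquareRootExistence.

(** * Vectors made of blocks and separable functions *)

Section Blocks.
Context {R : realType} {m : nat}.

Lemma sum_mxtens {q : nat} (F : 'I_(m * q) -> R) :
  \sum_k F k = \sum_(i < m) \sum_(a < q) F (mxtens_index (i, a)).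
Proof.
rewrite pair_bigA /= (reindex (@mxtens_index m q)) /=.
  by apply: eq_bigr => -[i a].
exists (@mxtens_unindex m q) => k _; [exact: mxtens_indexK|exact: mxtens_unindexK].
Qed.

Section OneSize.
Context {q : nat}.
Implicit Types u v : 'cV[R]_(m * q).

Lemma blkD i u v : blk i (u + v) = blk i u + blk i v.
Proof. by apply/matrixP => a j; rewrite !mxE. Qed.

Lemma blkZ i c u : blk i (c *: u) = c *: blk i u.
Proof. by apply/matrixP => a j; rewrite !mxE. Qed.

Lemma dot_blk u v : dot u v = \sum_i dot (blk i u) (blk i v).
Proof.
rewrite /dot sum_mxtens; apply: eq_bigr => i _; apply: eq_bigr => a _.
by rewrite !mxE.
Qed.

Lemma blk_ext u v : (forall i, blk i u = blk i v) -> u = v.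
Proof.
move=> uv; apply/matrixP => k j; rewrite ord1 {j}; case: (mxtens_indexP k) => i a.
by have /matrixP/(_ a 0) := uv i; rewrite !mxE.
Qed.

End OneSize.

Lemma bdiagE {r q : nat} (A : 'I_m -> 'M[R]_(r, q)) i j a b :
  bdiag A (mxtens_index (i, a)) (mxtens_index (j, b)) = (i == j)%:R * A i a b.
Proof.
rewrite /bdiag summxE (bigD1 i) //= big1 ?addr0 => [|l li].
  by rewrite tensmxE mxE eqxx /= eq_sym.
by rewrite tensmxE mxE eq_sym (negbTE li) mul0r.
Qed.

Lemma blk_bdiag {r q : nat} (A : 'I_m -> 'M[R]_(r, q)) i u :
  blk i (bdiag A *m u) = A i *m blk i u.
Proof.
apply/matrixP => a j; rewrite ord1 {j} !mxE sum_mxtens (bigD1 i) //=.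
rewrite [X in _ + X]big1 ?addr0 => [|l li]; last first.
  by apply: big1 => b _; rewrite bdiagE eq_sym (negbTE li) !mul0r.
by apply: eq_bigr => b _; rewrite bdiagE eqxx mul1r mxE.
Qed.

Lemma trmx_bdiag {r q : nat} (A : 'I_m -> 'M[R]_(r, q)) :
  (bdiag A)^T = bdiag (fun i => (A i)^T).
Proof.
rewrite /bdiag linear_sum /=; apply: eq_bigr => i _.
by rewrite trmx_tens trmx_delta.
Qed.

Lemma blk_Gamma_blk {q : nat} (tau : 'I_m -> R) i (u : 'cV[R]_(m * q)) :
  blk i (Gamma_blk q tau *m u) = tau i *: blk i u.
Proof. by rewrite blk_bdiag mul_scalar_mx. Qed.

Lemma trmx_Gamma_blk {q : nat} (tau : 'I_m -> R) :
  (Gamma_blk q tau)^T = Gamma_blk q tau.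
Proof. by rewrite trmx_bdiag; congr bdiag; apply/funext => i; rewrite tr_scalar_mx. Qed.

Lemma eq_mulmx_col {r q : nat} (A A' : 'M[R]_(r, q)) :
  (forall u : 'cV[R]_q, A *m u = A' *m u) -> A = A'.
Proof.
move=> e; apply/matrixP => i j.
by have := congr1 (fun w : 'cV[R]_r => w i 0) (e (delta_mx j 0)); rewrite -!colE !mxE.
Qed.

Lemma Gamma_blk_mulV {q : nat} (tau : 'I_m -> R) : (forall i, 0 < tau i) ->
  Gamma_blk q tau *m Gamma_blk q (fun i => (tau i)^-1) = 1%:M.
Proof.
move=> tau0; apply: eq_mulmx_col => u; apply: blk_ext => i.
by rewrite -mulmxA !blk_Gamma_blk scalerA mul1mx divff ?scale1r // gt_eqF.
Qed.

End Blocks.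

Section SeparableSums.
Context {R : realType} {m n p : nat}.

(** By linearity the difference quotients of [h \o l] at [x] along [v] are
    those of [h] at [l x] along [l v], whence no chain rule is needed. *)
Lemma is_derive_comp_linear {N M : nat} (h : 'cV[R]_M -> R)
    (l : {linear 'cV[R]_N -> 'cV[R]_M}) x v (a : R) :
  is_derive (l x) (l v) h a -> is_derive x v (h \o l) a.
Proof.
move=> [dh hE].
have e : (fun t : R => t^-1 *: ((h \o l \o shift x) (t *: v) - (h \o l) x)) =
   (fun t : R => t^-1 *: ((h \o shift (l x)) (t *: l v) - h (l x))).
  apply/funext => t /=.
  by have -> : l (t *: v + x) = t *: l v + l x by rewrite linearD linearZ.
split; first by rewrite /derivable e.
by rewrite -hE /derive e.
Qed.

Definition head_blk (i : 'I_m) (x : 'cV[R]_(m * n + m * p)) : 'cV[R]_n :=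
  blk i (usubmx x).

Lemma head_blk_is_linear i : linear (head_blk i).
Proof. by move=> c u v; rewrite /head_blk linearP blkD blkZ. Qed.

HB.instance Definition _ i := GRing.isLinear.Build _ _ _ _ (head_blk i)
  (head_blk_is_linear i).

Lemma dot_grad_Fsum (f : 'I_m -> 'cV[R]_n -> R) (x v : 'cV[R]_(m * n + m * p)) :
  (forall i z, differentiable (f i) z) ->
  dot (grad (Fsum f) x) v =
  \sum_i dot (grad (f i) (blk i (usubmx x))) (blk i (usubmx v)).
Proof.
move=> df.
have FE : Fsum f = \sum_(i < m) (f i \o head_blk i).
  by apply/funext => z; rewrite fct_sumE.
have dF w : 'D_w (Fsum f) x =
    \sum_i dot (grad (f i) (head_blk i x)) (head_blk i w).
  have dl i : is_derive x w (f i \o head_blk i)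
      (dot (grad (f i) (head_blk i x)) (head_blk i w)).
    apply: is_derive_comp_linear; split; first exact: diff_derivable.
    exact: derive_dot_grad.
  by rewrite FE derive_val.
have vE : v = \sum_j v j 0 *: (delta_mx j 0 : 'cV[R]__).
  by rewrite {1}(matrix_sum_delta v); apply: eq_bigr => j _; rewrite big_ord1.
rewrite {1}/dot; under eq_bigr do rewrite mxE dF mulr_suml.
rewrite exchange_big; apply: eq_bigr => i _ /=.
rewrite -/(head_blk i x) -/(head_blk i v) [in RHS]vE linear_sum dot_sumr.
by apply: eq_bigr => j _; rewrite linearZ /= dotZr mulrC.
Qed.

End SeparableSums.

Section LiftedProblem.
Context {R : realType} {m n p : nat}.
Let V := 'cV[R]_(m * n + m * p).

Definition tail_blk (i : 'I_m) (x : V) : 'cV[R]_p := blk i (dsubmx x).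

Lemma tail_blk_is_linear i : linear (tail_blk i).
Proof. by move=> c u v; rewrite /tail_blk linearP blkD blkZ. Qed.

HB.instance Definition _ i := GRing.isLinear.Build _ _ _ _ (tail_blk i)
  (tail_blk_is_linear i).

Lemma dot_blocks (u v : V) : dot u v =
  \sum_i (dot (head_blk i u) (head_blk i v) + dot (tail_blk i u) (tail_blk i v)).
Proof.
by rewrite -{1}(vsubmxK u) -{1}(vsubmxK v) dot_col_mx !dot_blk -big_split.
Qed.

Section NonsmoothPart.
Variable g : 'I_m -> 'cV[R]_p -> \bar R.
Hypotheses (cg : forall i, econvex (g i)) (pg : forall i, eproper (g i)).
Hypothesis clg : forall i, closed_fun (g i).

Lemma Gsum_econvex : econvex (Gsum (n := n) g).
Proof.
apply: (@econvex_sum _ _ _ _ (fun i => g i \o tail_blk i)) => i x.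
  exact: (pg i).1.
move=> y t t01 /=; rewrite linearD !linearZ; exact: cg.
Qed.

Lemma continuous_tail_blk i : continuous (tail_blk i).
Proof.
move=> x; apply/(@cvg_colP _ _ _ (nbhs_filter x)) => a; rewrite !mxE.
under eq_cvg do rewrite !mxE.
exact: (@coord_continuous _ _ _ _ 0 x).
Qed.

Lemma Gsum_lsc : lower_semicontinuous (Gsum (n := n) g).
Proof.
apply: (@lsc_sum _ _ _ _ (fun i => g i \o tail_blk i)) => i.
  by move=> x; exact: (pg i).1.
apply: lsc_comp; [exact: continuous_tail_blk|exact: closed_fun_lsc].
Qed.

Lemma Gsum_eproper : eproper (Gsum (n := n) g).
Proof.
split=> [x|].
  by apply: (@sum_neq_ninfty _ _ _ (fun i => g i (tail_blk i x))) => i; exact: (pg i).1.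
have /choice [z gz] (i : 'I_m) : exists z, (g i z < +oo)%E by exact: (pg i).2.
exists (col_mx 0 (\col_k z (mxtens_unindex k).1 (mxtens_unindex k).2 0)).
rewrite /Gsum lte_sum_pinfty // => i _; rewrite col_mxKd.
suff -> : blk i (\col_k z (mxtens_unindex k).1 (mxtens_unindex k).2 0) = z i by [].
by apply/matrixP => a j; rewrite ord1 !mxE mxtens_indexK.
Qed.

End NonsmoothPart.

Section SmoothPart.
Variables (f : 'I_m -> 'cV[R]_n -> R) (L : 'I_m -> R).
Hypotheses (L0 : forall i, 0 < L i) (df : forall i z, differentiable (f i) z).
Hypothesis cf : forall i, convex_function [set: 'cV[R]_n] (f i).
Hypothesis lipf : forall i z1 z2,
  enorm (grad (f i) z1 - grad (f i) z2) <= L i * enorm (z1 - z2).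

Let gF : V -> V := grad (Fsum f).

Lemma dot_grad_FsumB x z v : dot (gF x - gF z) v =
  \sum_i dot (grad (f i) (head_blk i x) - grad (f i) (head_blk i z)) (head_blk i v).
Proof.
rewrite dotBl /gF !dot_grad_Fsum // -sumrB; apply: eq_bigr => i _.
by rewrite dotBl.
Qed.

Lemma Fsum_ge_tangent (x z : V) : Fsum f x + dot (gF x) (z - x) <= Fsum f z.
Proof.
rewrite /gF dot_grad_Fsum // /Fsum -big_split; apply: ler_sum => i _ /=.
by rewrite -/(head_blk i (z - x)) linearB; apply: (convex_ge_tangent (@df i) (@lipf i)).
Qed.

Lemma Fsum_le_quadratic : exists K, forall x z : V,
  Fsum f z <= Fsum f x + dot (gF x) (z - x) + K * dot (z - x) (z - x).
Proof.
exists (\sum_i L i) => x z.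
rewrite /gF dot_grad_Fsum // /Fsum -big_split mulr_suml -big_split.
apply: ler_sum => i _ /=; rewrite -/(head_blk i (z - x)) linearB.
have := descent (@df i) (@lipf i) (head_blk i x) (head_blk i z).
rewrite ler_norml -/(head_blk i x) -/(head_blk i z) => /andP[_].
have : dot (head_blk i z - head_blk i x) (head_blk i z - head_blk i x)
    <= dot (z - x) (z - x).
  rewrite (dot_blocks (z - x)) (bigD1 i) //= linearB -addrA lerDl.
  by rewrite addr_ge0 ?dot_ge0 // sumr_ge0 // => j _; rewrite addr_ge0 ?dot_ge0.
move=> /(ler_wpM2l (ltW (L0 i))).
have : 0 <= L i * dot (z - x) (z - x) by rewrite mulr_ge0 ?dot_ge0 // ltW.
lra.
Qed.

Lemma grad_Fsum_lipschitz (x z : V) :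
  dot (gF x - gF z) (gF x - gF z) <= (\sum_i L i ^+ 2) * dot (x - z) (x - z).
Proof.
have := dot_grad_FsumB x z; set r := gF x - gF z; clearbody r => rE.
have rr : dot r r <= 2^-1 * ((\sum_i L i ^+ 2) * dot (x - z) (x - z)) + 2^-1 * dot r r.
  rewrite {1}rE mulr_suml (dot_blocks r) !mulr_sumr -big_split.
  apply: ler_sum => i _ /=; set D := _ - _.
  have DL : dot D D <= L i ^+ 2 * dot (x - z) (x - z).
    have -> : dot (x - z) (x - z) = enorm (x - z) ^+ 2 by rewrite sqr_enorm.
    rewrite -exprMn -enorm_le ?mulr_ge0 ?enorm_ge0 ?(ltW (L0 i)) //.
    apply: le_trans (lipf _ _ _) _; rewrite ler_wpM2l ?(ltW (L0 i)) //.
    rewrite enorm_le ?enorm_ge0 // sqr_enorm -linearB (dot_blocks (x - z)) (bigD1 i) //=.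
    rewrite -addrA lerDl addr_ge0 ?dot_ge0 // sumr_ge0 // => j _.
    by rewrite addr_ge0 ?dot_ge0.
  have := young D (head_blk i r) ltr01; have := dot_ge0 (tail_blk i r).
  rewrite invr1; lra.
lra.
Qed.

End SmoothPart.

Section StepSizes.
Variable tau : 'I_m -> R.
Hypothesis tau0 : forall i, 0 < tau i.

Lemma Gamma_col_mx (s : 'I_m -> R) (u : 'cV[R]_(m * n)) (v : 'cV[R]_(m * p)) :
  @Gamma R m n p s *m col_mx u v = col_mx (Gamma_blk n s *m u) (Gamma_blk p s *m v).
Proof. by rewrite mul_block_col !mul0mx addr0 add0r. Qed.

Lemma trmx_Gamma (s : 'I_m -> R) : (@Gamma R m n p s)^T = Gamma s.
Proof. by rewrite tr_block_mx !trmx0 !trmx_Gamma_blk. Qed.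

Lemma Gamma_mulV : @Gamma R m n p tau *m @Gamma R m n p (fun i => (tau i)^-1) = 1%:M.
Proof.
rewrite mulmx_block !mulmx0 !mul0mx !addr0 !add0r !Gamma_blk_mulV //.
by rewrite -scalar_mx_block.
Qed.

Lemma invmx_Gamma : invmx (@Gamma R m n p tau) = @Gamma R m n p (fun i => (tau i)^-1).
Proof.
have [Gu _] := mulmx1_unit Gamma_mulV.
by rewrite -[LHS]mulmx1 -Gamma_mulV mulKmx.
Qed.

Lemma sqnorm_Gamma (s : 'I_m -> R) (v : V) : dot v (@Gamma R m n p s *m v) =
  \sum_i s i * (dot (head_blk i v) (head_blk i v) + dot (tail_blk i v) (tail_blk i v)).
Proof.
rewrite dot_blocks; apply: eq_bigr => i _.
rewrite -{2 4}(vsubmxK v) Gamma_col_mx /head_blk /tail_blk col_mxKu col_mxKd.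
by rewrite !blk_Gamma_blk !dotZr mulrDr.
Qed.

Lemma sqnorm_Gamma_blk {q : nat} (u : 'cV[R]_(m * q)) :
  dot u (Gamma_blk q tau *m u) = \sum_i tau i * dot (blk i u) (blk i u).
Proof.
by rewrite dot_blk; apply: eq_bigr => i _; rewrite blk_Gamma_blk dotZr.
Qed.

End StepSizes.
End LiftedProblem.

(** * The mixing matrix and its consensus kernel *)

Section Mixing.
Context {R : realType} {m n : nat}.
Variables (E : rel 'I_m) (W : 'M[R]_m).
Hypothesis hW : mixing_matrix E W.

(** [Vmat W = 1 - mean_mx], where [mean_mx] inherits from [W] nonnegative
    entries and unit row sums. *)
Definition mean_mx : 'M[R]_(m * n) := tensmx (2^-1 *: (1%:M + W)) 1%:M.

Lemma mean_mxE i a j b :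
  mean_mx (mxtens_index (i, a)) (mxtens_index (j, b)) =
  2^-1 * ((i == j)%:R + W i j) * (a == b)%:R.
Proof. by rewrite tensmxE !mxE. Qed.

Lemma Vmat_mean : Vmat W = 1%:M - mean_mx.
Proof.
apply/matrixP => k l; case: (mxtens_indexP k) => i a; case: (mxtens_indexP l) => j b.
rewrite tensmxE [RHS]mxE [X in _ = _ + X]mxE mean_mxE !mxE.
rewrite (can_eq (@mxtens_indexK m n)) xpair_eqE.
by case: (i == j) (a == b) => -[] /=; field.
Qed.

Lemma mean_mx_sym : mean_mx^T = mean_mx.
Proof.
by rewrite trmx_tens trmx1 linearZ linearD /= trmx1; case: hW => ->.
Qed.

Lemma mean_mx_ge0 k l : 0 <= mean_mx k l.
Proof.
case: (mxtens_indexP k) => i a; case: (mxtens_indexP l) => j b.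
have [_ [W0 _ _] _ _ _] := hW.
by rewrite mean_mxE !mulr_ge0 ?invr_ge0 ?addr_ge0 ?ler0n.
Qed.

Lemma mean_mx_sum k : \sum_l mean_mx k l = 1.
Proof.
case: (mxtens_indexP k) => i a; have [_ [_ Wsum _] _ _ _] := hW.
rewrite sum_mxtens; under eq_bigr => j _.
  under eq_bigr do rewrite mean_mxE.
  rewrite -mulr_sumr (bigD1 a) //= eqxx big1 ?addr0 ?mulr1 => [|b ba]; last first.
    by rewrite eq_sym (negbTE ba).
  over.
rewrite -mulr_sumr big_split /= Wsum (bigD1 i) //= eqxx big1 ?addr0.
  by rewrite -[true%:R]/(1 : R); field.
by move=> j ji; rewrite eq_sym (negbTE ji).
Qed.

Lemma psd_sqrt_Vmat :
  psd (psd_sqrt (Vmat W : 'M[R]_(m * n))) /\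
  psd_sqrt (Vmat W : 'M[R]_(m * n)) *m psd_sqrt (Vmat W) = Vmat W.
Proof.
have := @xgetPex _ 0 [set S : 'M[R]_(m * n) | psd S /\ S *m S = Vmat W].
apply; rewrite Vmat_mean; apply: psd_sqrt_one_sub.
- exact: mean_mx_sym.
- exact: mean_mx_ge0.
- by move=> k; rewrite mean_mx_sum.
Qed.

(** Keep only the diagonal terms of [sum_weighted_sqr] at [s = 1]; they equal
    [4 * mean_mx k k * z k 0 ^+ 2], and [mean_mx k k] is at least
    [(1 + w) / 2]. This is where the positive diagonal of [W] excludes its
    eigenvalue [-1]. *)
Lemma mean_mx_coercive (w : R) (z : 'cV[R]_(m * n)) : (forall i, w <= W i i) ->
  w * dot z z <= dot z (mean_mx *m z).
Proof.
move=> hw; have := sum_weighted_sqr 1 z mean_mx_sym.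
under [X in _ = _ * X + _]eq_bigr do rewrite mean_mx_sum mul1r expr2.
rewrite -/(dot z z) => e.
have : \sum_k 2 * (1 + w) * (z k 0 * z k 0) <=
    \sum_i \sum_j mean_mx i j * (z i 0 + 1 * z j 0) ^+ 2.
  apply: ler_sum => k _; rewrite (bigD1 k) //= -[leLHS]addr0 lerD //; last first.
    by apply: sumr_ge0 => l _; rewrite mulr_ge0 ?sqr_ge0 ?mean_mx_ge0.
  case: (mxtens_indexP k) => i a; rewrite mean_mxE !eqxx -[true%:R]/(1 : R) mulr1.
  have : 0 <= (W i i - w) * z (mxtens_index (i, a)) 0 ^+ 2.
    by rewrite mulr_ge0 ?sqr_ge0 // subr_ge0.
  lra.
rewrite -mulr_sumr -/(dot z z) e; lra.
Qed.

Lemma sqrt_Vmat_contraction (w : R) (z : 'cV[R]_(m * n)) : (forall i, w <= W i i) ->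
  dot (psd_sqrt (Vmat W) *m z) (psd_sqrt (Vmat W) *m z) <= (1 - w) * dot z z.
Proof.
move=> hw; have [[Ssym _] SS] := psd_sqrt_Vmat.
rewrite dot_mulmx mulmxA Ssym SS Vmat_mean mulmxBl mul1mx dotBl.
rewrite mulrBl mul1r lerD2l lerN2 dotC; exact: mean_mx_coercive.
Qed.

Lemma sqrt_Vmat_tens (z : 'cV[R]_n) :
  psd_sqrt (Vmat W) *m (tensmx (const_mx 1 : 'cV[R]_m) z : 'cV[R]_(m * n)) = 0.
Proof.
pose u : 'cV[R]_(m * n) := tensmx (const_mx 1 : 'cV[R]_m) z.
rewrite -/u; apply: dot_eq0.
have [[Ssym _] SS] := psd_sqrt_Vmat.
rewrite dot_mulmx mulmxA Ssym SS.
have -> : Vmat W *m u = 0.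
  have [_ _ nullW _ _] := hW.
  have : [set c *: (const_mx 1 : 'cV[R]_m) | c in [set: R]] (const_mx 1).
    by exists 1 => //; rewrite scale1r.
  rewrite -nullW /= => W1.
  transitivity (tensmx (2^-1 *: (1%:M - W) *m (const_mx 1 : 'cV[R]_m)) (1%:M *m z)).
    exact: (@tensmx_mul R m m n n 1 1).
  by rewrite -scalemxAl W1 scaler0 tens0mx.
by rewrite dot0l.
Qed.

(** The kernel of [1 - W] consists of the constant vectors; it is used on each
    of the [n] coordinates separately. *)
Lemma sqrt_Vmat_ker (u : 'cV[R]_(m * n)) : psd_sqrt (Vmat W) *m u = 0 ->
  exists z : 'cV[R]_n, u = tensmx (const_mx 1 : 'cV[R]_m) z.
Proof.
move=> Su; have [_ SS] := psd_sqrt_Vmat.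
have Vu : Vmat W *m u = 0 by rewrite -SS -mulmxA Su mulmx0.
have [_ _ nullW _ _] := hW.
have /choice [c hc] (a : 'I_n) :
    exists c : R, forall i, u (mxtens_index (i, a)) 0 = c.
  pose v : 'cV[R]_m := \col_i u (mxtens_index (i, a)) 0.
  have : [set v : 'cV[R]_m | (1%:M - W) *m v = 0] v.
    apply/matrixP => i j; rewrite ord1 [RHS]mxE.
    have /matrixP/(_ (mxtens_index (i, a)) 0) := Vu.
    rewrite !mxE sum_mxtens => Vi; apply: (mulfI (x := 2^-1)) => //.
    rewrite mulr0 -[RHS]Vi mulr_sumr; apply: eq_bigr => l _.
    rewrite (bigD1 a) //= big1 ?addr0 => [|b ba].
      by rewrite tensmxE !mxE eqxx mulr1 mulrA.
    by rewrite tensmxE !mxE (eq_sym a b) (negbTE ba) mulr0 mul0r.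
  rewrite nullW => -[c _ cv]; exists c => i.
  have := congr1 (fun w : 'cV[R]_m => w i 0) cv.
  by rewrite !mxE mulr1.
exists (\col_a c a); apply/matrixP => k j; case: (mxtens_indexP k) => i a.
by rewrite ord1 hc !mxE mxtens_indexK mul1r.
Qed.

End Mixing.

Section Consensus.
Context {R : realType} {m n p : nat}.
Variables (E : rel 'I_m) (W : 'M[R]_m) (U : 'I_m -> 'M[R]_(p, n)).
Hypothesis hW : mixing_matrix E W.

Definition consensus (z : 'cV[R]_n) : 'cV[R]_(m * n) :=
  tensmx (const_mx 1 : 'cV[R]_m) z.

Definition lift_consensus (z : 'cV[R]_n) : 'cV[R]_(m * n + m * p) :=
  col_mx (consensus z) (bdiag U *m consensus z).

Lemma blk_consensus i z : blk i (consensus z) = z.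
Proof. by apply/matrixP => a j; rewrite ord1 !mxE mxtens_indexK mul1r !ord1. Qed.

Lemma Bmat_ker x : Bmat W U *m x = 0 -> exists z, x = lift_consensus z.
Proof.
rewrite -(vsubmxK x); move: (usubmx x) (dsubmx x) => a b {x}.
rewrite mul_block_col mul0mx addr0 mulNmx mul1mx -[X in _ = X]vsubmxK.
move=> /eq_col_mx [/=]; rewrite !linear0 => /(sqrt_Vmat_ker hW) [z az] /eqP.
by rewrite subr_eq0 => /eqP <-; exists z; rewrite az.
Qed.

Lemma Bmat_lift z : Bmat W U *m lift_consensus z = 0.
Proof.
rewrite mul_block_col mul0mx addr0 mulNmx mul1mx subrr.
by rewrite (sqrt_Vmat_tens hW) col_mx0.
Qed.

Lemma Fsum_lift (f : 'I_m -> 'cV[R]_n -> R) z :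
  Fsum f (lift_consensus z) = \sum_i f i z.
Proof. by apply: eq_bigr => i _; rewrite col_mxKu blk_consensus. Qed.

Lemma Gsum_lift (g : 'I_m -> 'cV[R]_p -> \bar R) z :
  Gsum g (lift_consensus z) = (\sum_i g i (U i *m z))%E.
Proof. by apply: eq_bigr => i _; rewrite col_mxKd blk_bdiag blk_consensus. Qed.

End Consensus.

(** * The two metrics of the iteration *)

Section FiniteBounds.
Context {R : realType}.

Lemma pos_lower_bound {I : finType} (a : I -> R) : (forall i, 0 < a i) ->
  exists2 c, 0 < c & forall i, c <= a i.
Proof.
move=> a0; exists (\big[Num.min/1]_i a i); last by move=> i; exact: bigmin_le_cond.
by apply: lt_bigmin.
Qed.

End FiniteBounds.

Section Metrics.
Context {R : realType} {m n p : nat}.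
Let V := 'cV[R]_(m * n + m * p).
Variables (tau : 'I_m -> R).
Hypothesis tau0 : forall i, 0 < tau i.

(** Blockwise [grad_monotone_shifted]: the metric contributes [(tau i)^-1] and
    the shifted gradient takes away at most [L i / 2]. *)
Lemma grad_Fsum_absorbed (f : 'I_m -> 'cV[R]_n -> R) (L : 'I_m -> R) (c : R)
    (x u s : V) :
  (forall i, 0 < L i) -> (forall i z, differentiable (f i) z) ->
  (forall i, convex_function [set: 'cV[R]_n] (f i)) ->
  (forall i z1 z2,
     enorm (grad (f i) z1 - grad (f i) z2) <= L i * enorm (z1 - z2)) ->
  (forall i, c <= (tau i)^-1 - L i / 2) ->
  c * dot (x - u) (x - u) <= dot (x - u) (invmx (Gamma tau) *m (x - u))
    + 2 * dot (u - s) (grad (Fsum f) x - grad (Fsum f) s).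
Proof.
move=> L0 df cf lipf hc.
rewrite invmx_Gamma // sqnorm_Gamma (dotC (u - s)) dot_grad_FsumB // dot_blocks.
rewrite !mulr_sumr -big_split; apply: ler_sum => i _ /=.
have := grad_monotone_shifted (@df i) (@lipf i) (@cf i)
  (head_blk i x) (head_blk i u) (head_blk i s) (L0 i).
rewrite (dotC (_ - head_blk i s)) -!linearB.
have h1 : 0 <= ((tau i)^-1 - L i / 2 - c)
    * dot (head_blk i (x - u)) (head_blk i (x - u)).
  by rewrite mulr_ge0 ?dot_ge0 // subr_ge0.
have h2 : 0 <= ((tau i)^-1 - c)
    * dot (tail_blk i (x - u)) (tail_blk i (x - u)).
  rewrite mulr_ge0 ?dot_ge0 // subr_ge0 (le_trans (hc i)) // gerBl.
  by rewrite divr_ge0 // ltW.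
lra.
Qed.

Variables (E : rel 'I_m) (W : 'M[R]_m) (U : 'I_m -> 'M[R]_(p, n)) (beta : R).
Hypotheses (hW : mixing_matrix E W) (beta0 : 0 < beta).
Hypothesis taubeta : forall i, tau i * beta < 1.

Lemma trmx_Smat : (Smat U tau beta)^T = Smat U tau beta.
Proof.
by rewrite /Smat !(linearD, linearZ) /= !trmx_mul !trmxK !trmx_Gamma_blk !mulmxA.
Qed.

Lemma trmx_Qmat : (Qmat U tau beta)^T = Qmat U tau beta.
Proof. by rewrite tr_block_mx !trmx0 tr_scalar_mx trmx_Smat. Qed.

Lemma trmx_Bmat_col_mx (a : 'cV[R]_(m * n)) (b : 'cV[R]_(m * p)) :
  (Bmat W U)^T *m col_mx a b =
  col_mx (psd_sqrt (Vmat W) *m a + (bdiag U)^T *m b) (- b).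
Proof.
have [[Ssym _] _] := psd_sqrt_Vmat (n := n) hW.
rewrite tr_block_mx mul_block_col Ssym !trmx0 mul0mx add0r.
by rewrite linearN /= trmx1 mulNmx mul1mx.
Qed.

(** The cross term [2 * dot s (Gamma r)], with [s] and [r] the contributions of
    the two dual blocks to the first primal block, is absorbed by Young's
    inequality with weight [beta / (1 - tau_max * beta)]: this is the reason
    for the last summand of [Smat]. *)
Lemma Qmat_dominates (w t c : R) (z : V) :
  (forall i, w <= W i i) -> (forall i, t <= tau i) ->
  c <= w / beta -> c <= t ->
  dot ((Bmat W U)^T *m z) (Gamma tau *m ((Bmat W U)^T *m z)) + c * dot z z
    <= dot z (Qmat U tau beta *m z).
Proof.
move=> hw ht cw ct; rewrite -(vsubmxK z).
move: (usubmx z) (dsubmx z) => a b {z}.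
rewrite trmx_Bmat_col_mx Gamma_col_mx !dot_col_mx.
have tmax : tau_max tau < beta^-1.
  apply: bigmax_lt => [|i _]; first by rewrite invr_gt0.
  by rewrite -div1r ltr_pdivlMr.
set s := psd_sqrt (Vmat W) *m a; set r := (bdiag U)^T *m b.
pose kappa := beta / (1 - tau_max tau * beta).
have den0 : 0 < 1 - tau_max tau * beta.
  by rewrite subr_gt0 -ltr_pdivlMr // div1r.
have kappa0 : 0 < kappa by rewrite divr_gt0.
have kappaV : kappa^-1 = beta^-1 - tau_max tau.
  by rewrite invf_div; field; rewrite gt_eqF.
set G1 := Gamma_blk n tau; set G2 := Gamma_blk p tau.
have -> : dot (- b) (G2 *m - b) = dot b (G2 *m b).
  by rewrite mulmxN dotNl dotNr opprK.
have Qz : Qmat U tau beta *m col_mx a b = col_mx (beta^-1 *: a) (Smat U tau beta *m b).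
  by rewrite mul_block_col !mul0mx addr0 add0r mul_scalar_mx.
rewrite Qz dot_col_mx dotZr.
have G1sym : G1^T = G1 by exact: trmx_Gamma_blk.
have bS : dot b (Smat U tau beta *m b) =
    2 * dot b (G2 *m b) + dot r (G1 *m r) + kappa * dot (G1 *m r) (G1 *m r).
  rewrite /Smat !mulmxDl -!scalemxAl !dotDr !dotZr -/kappa -/G1 -/G2 -!mulmxA.
  by rewrite -/r !(dot_mulmx (bdiag U)) -/r (dot_mulmx G1 r (G1 *m r)) G1sym.
have sr : dot (s + r) (G1 *m (s + r)) =
    dot s (G1 *m s) + 2 * dot s (G1 *m r) + dot r (G1 *m r).
  have := sqnorm_wrtD s r G1sym; rewrite /sqnorm_wrt => ->.
  by rewrite (dot_mulmx G1 s r) G1sym.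
rewrite bS sr.
have kappaV0 : 0 < kappa^-1 by rewrite invr_gt0.
have cross := young s (G1 *m r) kappaV0; rewrite invrK kappaV in cross.
have s1 : dot s (G1 *m s) <= tau_max tau * dot s s.
  rewrite sqnorm_Gamma_blk dot_blk mulr_sumr; apply: ler_sum => i _.
  by rewrite ler_wpM2r ?dot_ge0 // /tau_max le_bigmax.
have b1 : t * dot b b <= dot b (G2 *m b).
  rewrite sqnorm_Gamma_blk dot_blk mulr_sumr; apply: ler_sum => i _.
  by rewrite ler_wpM2r ?dot_ge0.
have s2 : beta^-1 * dot s s <= beta^-1 * dot a a - w / beta * dot a a.
  have := sqrt_Vmat_contraction hW a hw; rewrite -/s.
  rewrite -(ler_pM2l (x := beta^-1)) ?invr_gt0 //; lra.
have a1 : c * dot a a <= w / beta * dot a a by rewrite ler_wpM2r ?dot_ge0.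
have b2 : c * dot b b <= t * dot b b by rewrite ler_wpM2r ?dot_ge0.
clearbody s r G1 G2 kappa; lra.
Qed.

End Metrics.

(** * Convergence of the decentralized method *)

Theorem theorem5 (R : realType) (m n p : nat)
    (E : rel 'I_m) (W : 'M[R]_m) (U : 'I_m -> 'M[R]_(p, n))
    (f : 'I_m -> 'cV[R]_n -> R) (g : 'I_m -> 'cV[R]_p -> \bar R)
    (L tau : 'I_m -> R) (beta : R) (eps : nat -> R)
    (d : nat -> 'cV[R]_(m * p))
    (xt x y : nat -> 'cV[R]_(m * n + m * p))
    (hE : undirected_connected E)
    (hW : mixing_matrix E W)
    (hsaddle : saddle_points W U f g !=set0)
    (hL : forall i, 0 < L i)
    (hf_convex : forall i, convex_function [set: 'cV[R]_n] (f i))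
    (hf_diff : forall i (z : 'cV[R]_n), differentiable (f i) z)
    (hf_lip : forall i z1 z2,
       enorm (grad (f i) z1 - grad (f i) z2) <= L i * enorm (z1 - z2))
    (hg_convex : forall i, econvex (g i))
    (hg_proper : forall i, eproper (g i))
    (hg_closed : forall i, closed_fun (g i))
    (htau : forall i, 0 < tau i < 2 / L i)
    (hbeta : 0 < beta)
    (htaubeta : forall i, 0 < tau i * beta < 1)
    (heps : forall k, 0 <= eps k)
    (hVDISA : VDISA W U f g tau beta eps d xt x y)
    (hsum : cvgn (series eps)) :
  let w := fun k : nat => col_mx (x k) (y k) in
  let v := fun k : nat => col_mx (xt k) (y k) in
  (forall ws, saddle_points W U f g ws ->
     bounded_seq (fun k => enorm (w k - ws)) /\
     bounded_seq (fun k => enorm (v k - ws))) /\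
  (exists winf, saddle_points W U f g winf /\ w @ \oo --> winf) /\
  (exists xinf : 'cV[R]_n,
     (fun k => usubmx (x k)) @ \oo
       --> (tensmx (const_mx 1 : 'cV[R]_m) xinf : 'cV[R]_(m * n)) /\
     argmin (fun z : 'cV[R]_n =>
       (\sum_(i < m) ((f i z)%:E + g i (U i *m z)))%E) xinf).
Proof.
have tau0 i : 0 < tau i by have /andP[] := htau i.
have taubeta1 i : tau i * beta < 1 by have /andP[] := htaubeta i.
pose B := Bmat W U; pose Gam : 'M[R]_(m * n + m * p) := Gamma tau.
pose P := invmx Gam; pose Q := Qmat U tau beta.
pose G : 'cV[R]_(m * n + m * p) -> \bar R := Gsum g.
pose gF := grad (Fsum (p := p) f).
have cG : econvex G by exact: Gsum_econvex.
have pG : eproper G by exact: Gsum_eproper.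
have lG : lower_semicontinuous G by exact: Gsum_lsc.
have Fge := Fsum_ge_tangent (p := p) hf_diff hf_convex hf_lip.
have [K Fle] := Fsum_le_quadratic (p := p) hL hf_diff hf_lip.
have saddleP ws : saddle_points W U f g ws <->
    kkt G gF B (usubmx ws) (dsubmx ws).
  exact: (saddle_kktP B cG pG Fge Fle).
have PE : P = Gamma (fun i => (tau i)^-1) by exact: invmx_Gamma.
have Psym : P^T = P by rewrite PE trmx_Gamma.
have GamP : Gam *m P = 1%:M by rewrite PE; exact: Gamma_mulV.
have PGam : P *m Gam = 1%:M by exact: mulmx1C.
have Qsym : Q^T = Q by exact: trmx_Qmat.
have Wdiag i : 0 < W i i by have [_ _ _ _] := hW; apply; rewrite eqxx.
have step0 i : 0 < (tau i)^-1 - L i / 2.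
  have /andP[_] := htau i; rewrite subr_gt0 => tL.
  by rewrite -[ltLHS]invrK ltf_pV2 ?posrE ?invr_gt0 ?divr_gt0 // invf_div.
have [wm wm0 hwm] := pos_lower_bound Wdiag.
have [tm tm0 htm] := pos_lower_bound tau0.
have [hm hm0 hhm] := pos_lower_bound step0.
(* [wm] bounds 1 minus the eigenvalues of [Vmat W] from below, [tm] the step
   sizes, and [hm] the room left below the critical step sizes [2 / L i]. *)
pose c := Num.min (wm / beta) (Num.min tm hm).
have c0 : 0 < c by rewrite !lt_min divr_gt0 //= tm0 hm0.
have cw : c <= wm / beta by rewrite ge_min lexx.
have ct : c <= tm by rewrite !ge_min lexx orbT.
have ch i : c <= (tau i)^-1 - L i / 2.
  by apply: le_trans (hhm i); rewrite !ge_min lexx !orbT.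
have Qbig z := Qmat_dominates U hW hbeta taubeta1 z hwm htm cw ct.
have mono x' u s := grad_Fsum_absorbed (p := p) tau0 x' u s hL hf_diff hf_convex hf_lip ch.
have glip := grad_Fsum_lipschitz (p := p) hL hf_diff hf_lip.
have [_ hrun] := hVDISA.
pose dd k : 'cV[R]_(m * n + m * p) := col_mx 0 (d k).
(* [d k] stacks [m] blocks of norm at most [eps k]. *)
pose e k := Num.sqrt m%:R * eps k.
have xt_step k : subdiff G (xt k.+1)
    (P *m (x k - xt k.+1) - gF (x k) - B^T *m y k + dd k).
  have [_ hprox _ _] := hrun k.
  have PGamE u : P *m (Gam *m u) = u by rewrite mulmxA PGam mul1mx.
  have qE : P *m (x k - xt k.+1) - gF (x k) - B^T *m y k + dd k =
      0 - P *m (xt k.+1 - (x k - Gam *m gF (x k) - Gam *m (B^T *m y k) + Gam *m dd k)).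
    rewrite sub0r -(mulmxN P) opprB !(mulmxDr P) !(mulmxN P) !PGamE.
    by rewrite -!addrA; congr (_ + _); rewrite addrC -!addrA.
  rewrite qE; apply: (subdiff_of_quadratic_argmin Psym cG pG _ hprox) => z.
  by rewrite dot0l subr0.
have y_step k : Q *m (y k.+1 - y k) = B *m xt k.+1.
  have [_ _ hy _] := hrun k.
  have cv0 : econvex (fun _ : 'cV[R]_(m * n + m * p) => 0%E : \bar R).
    by move=> a b t t01; rewrite !mule0 adde0.
  have pr0 : eproper (fun _ : 'cV[R]_(m * n + m * p) => 0%E : \bar R).
    by split=> //; exists 0; rewrite ltry.
  have sub : subdiff (fun _ : 'cV[R]_(m * n + m * p) => 0%E : \bar R) (y k.+1)
      (B *m xt k.+1 - Q *m (y k.+1 - y k)).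
    apply: (subdiff_of_quadratic_argmin Qsym cv0 pr0 _ hy) => z.
    by rewrite add0e -dot_mulmx dotC.
  apply/esym/eqP; rewrite -subr_eq0; apply/eqP.
  move: sub; set q := B *m _ - _ => /(_ (y k.+1 + q)).
  rewrite (addrC _ q) addrK add0e lee_fin => q0.
  by apply/dot_eq0/eqP; rewrite eq_le q0 dot_ge0.
have x_step k : x k.+1 = xt k.+1 + Gam *m (B^T *m (y k - y k.+1)).
  by have [_ _ _] := hrun k.
have e0 k : 0 <= e k by rewrite mulr_ge0 ?sqrtr_ge0.
have esum : cvgn (series e).
  by apply: is_cvg_seriesZ.
have d_le k : enorm (dd k) <= e k.
  have [hd _ _ _] := hrun k.
  rewrite enorm_le // dot_col_mx dot0l add0r dot_blk exprMn sqr_sqrtr ?ler0n //.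
  rewrite mulr_natl -[X in _ *+ X]card_ord -sumr_const.
  by apply: ler_sum => i _; rewrite -enorm_le.
have bounded ws : saddle_points W U f g ws -> exists C, forall k,
    [/\ enorm (x k - usubmx ws) <= C, enorm (y k - dsubmx ws) <= C
      & enorm (xt k.+1 - usubmx ws) <= C].
  move=> /saddleP; exact: (kkt_bounded c0 pG Psym Qsym PGam Qbig mono
    xt_step y_step x_step e0 esum d_le).
have split_enorm a b (ws : 'cV[R]_((m * n + m * p) + (m * n + m * p))) :
    enorm (col_mx a b - ws) <= enorm (a - usubmx ws) + enorm (b - dsubmx ws).
  rewrite enorm_le ?addr_ge0 ?enorm_ge0 // -{1 2}(vsubmxK ws) opp_col_mx add_col_mx.
  rewrite dot_col_mx -!sqr_enorm.
  have := enorm_ge0 (a - usubmx ws); have := enorm_ge0 (b - dsubmx ws); nra.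
have [xs [ys [ws xcv ycv]]] : exists xs ys,
    [/\ kkt G gF B xs ys, x k @[k --> \oo] --> xs & y k @[k --> \oo] --> ys].
  apply: (primal_dual_cvg c0 pG lG Psym Qsym PGam Qbig mono glip
    xt_step y_step x_step e0 esum d_le).
  by have [ws /saddleP] := hsaddle; exists (usubmx ws), (dsubmx ws).
have sad : saddle_points W U f g (col_mx xs ys).
  by apply/saddleP; rewrite col_mxKu col_mxKd.
move=> w v; split; [|split].
- move=> ws' /bounded [C hC]; split.
    exists (C + C) => k; rewrite ger0_norm ?enorm_ge0 //.
    by have [h1 h2 _] := hC k; rewrite (le_trans (split_enorm _ _ _)) // lerD.
  (* [xt 0] is arbitrary: the estimates only concern [xt k.+1]. *)
  exists (C + C + enorm (xt 0%N - usubmx ws')) => k.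
  rewrite ger0_norm ?enorm_ge0 // (le_trans (split_enorm _ _ _)) //.
  have C0 : 0 <= C by have [h _ _] := hC 0%N; apply: le_trans h; exact: enorm_ge0.
  have [_ h2 _] := hC k; have E0 := enorm_ge0 (xt 0%N - usubmx ws').
  case: k h2 => [|k] h2; first by lra.
  by have [_ _ h3] := hC k; lra.
- exists (col_mx xs ys); split=> //; apply/cvg_colP => i.
  rewrite /w -[i](splitK i); case: (fintype.split i) => j /=.
    rewrite col_mxEu; under eq_cvg do rewrite col_mxEu.
    by move/cvg_colP : xcv; exact.
  rewrite col_mxEd; under eq_cvg do rewrite col_mxEd.
  by move/cvg_colP : ycv; exact.
have [z xsE] := Bmat_ker hW ws.2.
exists z; split.
  apply/cvg_colP => i; rewrite -/(consensus z).
  have -> : consensus z i 0 = xs (lshift _ i) 0 by rewrite xsE col_mxEu.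
  under eq_cvg do rewrite mxE.
  by move/cvg_colP : xcv; exact.
have objE z' : (\sum_(i < m) ((f i z')%:E + g i (U i *m z')))%E =
    ((Fsum f (lift_consensus U z'))%:E + G (lift_consensus U z'))%E.
  by rewrite big_split /= Fsum_lift -sumEFin /G Gsum_lift.
split=> [|z']; rewrite !objE -xsE.
  have := subdiff_fin_num pG ws.1; case: (G xs) => [r| |] // _.
  by rewrite -EFinD ltry.
have := (sad (lift_consensus U z') ys).2.
by rewrite /lagrangian col_mxKu col_mxKd xsE !(Bmat_lift _ hW) !dot0r !adde0.
Qed.
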